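(* Consider the uplink system model described in the context, and suppose the IOS phase shifts are chosen so that $|\overline{\mathbf a}^{(\mathrm{IOS})\mathrm H}_{\mathrm i}\mathbf\Theta_{\mathrm i}\overline{\mathbf g}_{\mathrm i}|^2=N_{\mathrm i}^2$ for both $\mathrm i\in\{\mathrm r,\mathrm t\}$. For $\mathrm i\in\{\mathrm r,\mathrm t\}$ let $\bar{\mathrm i}$ denote the other user, define $$\zeta_{\mathrm i}=\hat{\mathbf h}_{\mathrm i}^{\mathrm H}\mathbf R^{-1}\hat{\mathbf h}_{\mathrm i}-\frac{\rho_{\bar{\mathrm i}}\varepsilon_{\mathbf v}\hat{\mathbf h}_{\mathrm i}^{\mathrm H}\mathbf R^{-1}\hat{\mathbf h}_{\bar{\mathrm i}}\hat{\mathbf h}_{\bar{\mathrm i}}^{\mathrm H}\mathbf R^{-1}\hat{\mathbf h}_{\mathrm i}}{1+\rho_{\bar{\mathrm i}}\varepsilon_{\mathbf v}\hat{\mathbf h}_{\bar{\mathrm i}}^{\mathrm H}\mathbf R^{-1}\hat{\mathbf h}_{\bar{\mathrm i}}},\qquad \mathcal R_{\mathrm{erg},\mathrm i}=\mathbb E\left[\log_2\left(1+\frac{\rho_{\mathrm i}\varepsilon_{\mathbf v}\varepsilon_{u,\mathrm i}\zeta_{\mathrm i}}{1+\rho_{\mathrm i}\varepsilon_{\mathbf v}(1-\varepsilon_{u,\mathrm i})\zeta_{\mathrm i}}\right)\right],$$ and let $$\eta_{\mathrm i}=\frac{\varrho_{\mathbf A_{\mathrm i}}\varrho_{\mathbf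 g_{\mathrm i}}\big(\kappa_{\mathbf A_{\mathrm i}}\kappa_{\mathbf g_{\mathrm i}}N_{\mathrm i}^2+(1+\kappa_{\mathbf g_{\mathrm i}}+\kappa_{\mathbf A_{\mathrm i}})N_{\mathrm i}\big)}{(1+\kappa_{\mathbf A_{\mathrm i}})(1+\kappa_{\mathbf g_{\mathrm i}})}+\varrho_{\mathbf b_{\mathrm i}}.$$ Then the ergodic spectral efficiency satisfies $\mathcal R_{\mathrm{erg},\mathrm i}\le\ddot{\mathcal R}'_{\mathrm{erg},\mathrm i}$ (a loose upper bound), where $$\ddot{\mathcal R}'_{\mathrm{erg},\mathrm i}=\log_2\left(1+\frac{\rho_{\mathrm i}\varepsilon_{\mathbf v}\varepsilon_{u,\mathrm i}M\eta_{\mathrm i}}{\rho_{\mathrm i}\varepsilon_{\mathbf v}(1-\varepsilon_{u,\mathrm i})M\eta_{\mathrm i}+\rho_{\mathrm r}(1-\varepsilon_{\mathbf v})\eta_{\mathrm r}+\rho_{\mathrm t}(1-\varepsilon_{\mathbf v})\eta_{\mathrm t}+\sigma_w^2}\right).$$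
   Context: System: an access point (AP) with $M$ antennas forming a uniform linear array with spacing $d_0$ (wavelength $\lambda$) serves two single-antenna users indexed $\mathrm i\in\{\mathrm r,\mathrm t\}$. An intelligent omni-surface (IOS) has $N_{\mathrm r}=N_{\mathrm r}^xN_{\mathrm r}^y$ elements serving user $\mathrm r$ and $N_{\mathrm t}=N_{\mathrm t}^xN_{\mathrm t}^y$ elements serving user $\mathrm t$, with element spacings $\delta_x,\delta_y$. The deterministic phase-shift matrices are $\mathbf\Theta_{\mathrm i}=\mathrm{diag}(e^{\jmath\theta_{\mathrm i,1}},\dots,e^{\jmath\theta_{\mathrm i,N_{\mathrm i}}})$, $\theta_{\mathrm i,n}\in[0,2\pi)$, where $\jmath=\sqrt{-1}$. Constants: path losses $\varrho_{\mathbf A_{\mathrm i}},\varrho_{\mathbf g_{\mathrm i}},\varrho_{\mathbf b_{\mathrm i}}>0$, Rician factors $\kappa_{\mathbf A_{\mathrm i}},\kappa_{\mathbf g_{\mathrm i}}\ge0$, deterministic angles $\phi_{\mathrm i},\varphi_{\mathrm i},\omega_{\mathrm i},\varpi_{\mathrm i},\psi_{\mathrm i}$. Deterministic vectors: $\overline{\mathbf g}_{\mathrm i}\in\mathbb C^{N_{\mathrm i}}$ has the entry indexed by $(n_x,n_y)$, $n_x\in\{0,\dots,N_{\mathrm i}^x-1\}$, $n_y\in\{0,\dots,N_{\mathrm i}^y-1\}$, equal to $\exp\big(\jmath\frac{2\pi}{\lambda}(\delta_xn_x\sin\phi_{\mathrm i}\cos\varphi_{\mathrm i}+\delta_yn_y\cos\phi_{\mathrm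 i})\big)$; $\overline{\mathbf a}^{(\mathrm{IOS})}_{\mathrm i}\in\mathbb C^{N_{\mathrm i}}$ is defined in the same way (same indexing) with $(\omega_{\mathrm i},\varpi_{\mathrm i})$ in place of $(\phi_{\mathrm i},\varphi_{\mathrm i})$; $\overline{\mathbf a}^{(\mathrm{AP})}_{\mathrm i}\in\mathbb C^M$ has $m$-th entry $\exp(\jmath\frac{2\pi}{\lambda}d_0(m-1)\cos\psi_{\mathrm i})$; $\overline{\mathbf A}_{\mathrm i}=\overline{\mathbf a}^{(\mathrm{AP})}_{\mathrm i}\overline{\mathbf a}^{(\mathrm{IOS})\mathrm H}_{\mathrm i}$. Random channels: $\mathbf b_{\mathrm i}\sim\mathcal{CN}(\mathbf 0,\mathbf I_M)$; $\mathbf g_{\mathrm i}=\sqrt{\kappa_{\mathbf g_{\mathrm i}}/(1+\kappa_{\mathbf g_{\mathrm i}})}\,\overline{\mathbf g}_{\mathrm i}+\sqrt{1/(1+\kappa_{\mathbf g_{\mathrm i}})}\,\widetilde{\mathbf g}_{\mathrm i}$ with $\widetilde{\mathbf g}_{\mathrm i}\sim\mathcal{CN}(\mathbf 0,\mathbf I_{N_{\mathrm i}})$; $\mathbf A_{\mathrm i}=\sqrt{\kappa_{\mathbf A_{\mathrm i}}/(1+\kappa_{\mathbf A_{\mathrm i}})}\,\overline{\mathbf A}_{\mathrm i}+\sqrt{1/(1+\kappa_{\mathbf A_{\mathrm i}})}\,\widetilde{\mathbf A}_{\mathrm i}$ where $\widetilde{\mathbf A}_{\mathrm i}\in\mathbb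 C^{M\times N_{\mathrm i}}$ has i.i.d. $\mathcal{CN}(0,1)$ entries; all of $\mathbf b_{\mathrm r},\mathbf b_{\mathrm t},\widetilde{\mathbf g}_{\mathrm r},\widetilde{\mathbf g}_{\mathrm t},\widetilde{\mathbf A}_{\mathrm r},\widetilde{\mathbf A}_{\mathrm t}$ are mutually independent. Equivalent channel: $\mathbf h_{\mathrm i}=\sqrt{\varrho_{\mathbf A_{\mathrm i}}\varrho_{\mathbf g_{\mathrm i}}}\mathbf A_{\mathrm i}\mathbf\Theta_{\mathrm i}\mathbf g_{\mathrm i}+\sqrt{\varrho_{\mathbf b_{\mathrm i}}}\mathbf b_{\mathrm i}$, with mean $\overline{\mathbf h}_{\mathrm i}=\mathbb E[\mathbf h_{\mathrm i}]$. Below $\mathbf C_{\mathbf x\mathbf y}=\mathbb E[(\mathbf x-\mathbb E\mathbf x)(\mathbf y-\mathbb E\mathbf y)^{\mathrm H}]$ computed under this model. Channel estimation with hardware impairments: hardware quality factors $\varepsilon_{\mathbf v},\varepsilon_{u,\mathrm r},\varepsilon_{u,\mathrm t}\in[0,1]$, transmit powers $\rho_{\mathrm r},\rho_{\mathrm t}>0$, noise variance $\sigma_w^2>0$, pilot length $K\ge1$. The processed pilot observation for user $\mathrm r$ is $\mathbf x_{\mathrm r}=\sqrt{K\rho_{\mathrm r}\varepsilon_{\mathbf v}\varepsilon_{u,\mathrm r}}\mathbf h_{\mathrm r}+\sqrt{\rho_{\mathrm r}\varepsilon_{\mathbf v}(1-\varepsilon_{u,\mathrm r})}\mathbf h_{\mathrm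 r}u_{\mathrm r}+\sqrt{\rho_{\mathrm t}\varepsilon_{\mathbf v}(1-\varepsilon_{u,\mathrm t})}\mathbf h_{\mathrm t}u_{\mathrm t}+\sqrt{\rho_{\mathrm r}(1-\varepsilon_{\mathbf v})}\mathbf h_{\mathrm r}\odot\mathbf v_{\mathrm r}+\sqrt{\rho_{\mathrm t}(1-\varepsilon_{\mathbf v})}\mathbf h_{\mathrm t}\odot\mathbf v_{\mathrm t}+\mathbf w$, where $u_{\mathrm r},u_{\mathrm t}\sim\mathcal{CN}(0,1)$, $\mathbf v_{\mathrm r},\mathbf v_{\mathrm t}\sim\mathcal{CN}(\mathbf 0,\mathbf I_M)$, $\mathbf w\sim\mathcal{CN}(\mathbf 0,\sigma_w^2\mathbf I_M)$ are independent of each other and of the channels ($\odot$ = entrywise product); $\mathbf x_{\mathrm t}$ is defined symmetrically (roles of $\mathrm r$ and $\mathrm t$ swapped, with fresh independent impairment and noise variables). The LMMSE estimates are $\hat{\mathbf h}_{\mathrm i}=\overline{\mathbf h}_{\mathrm i}+\mathbf C_{\mathbf h_{\mathrm i}\mathbf x_{\mathrm i}}\mathbf C_{\mathbf x_{\mathrm i}\mathbf x_{\mathrm i}}^{-1}(\mathbf x_{\mathrm i}-\mathbb E[\mathbf x_{\mathrm i}])$, with $\mathbf C_{\hat{\mathbf h}_{\mathrm i}\hat{\mathbf h}_{\mathrm i}}=\mathbf C_{\mathbf h_{\mathrm i}\mathbf x_{\mathrm i}}\mathbf C_{\mathbf x_{\mathrm i}\mathbf x_{\mathrm i}}^{-1}\mathbf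 C_{\mathbf h_{\mathrm i}\mathbf x_{\mathrm i}}^{\mathrm H}$ and error covariance $\mathbf C_{\check{\mathbf h}_{\mathrm i}\check{\mathbf h}_{\mathrm i}}=\mathbf C_{\mathbf h_{\mathrm i}\mathbf h_{\mathrm i}}-\mathbf C_{\hat{\mathbf h}_{\mathrm i}\hat{\mathbf h}_{\mathrm i}}$. The matrix $\mathbf R\in\mathbb C^{M\times M}$ is $\mathbf R=\rho_{\mathrm r}\varepsilon_{\mathbf v}(1-\varepsilon_{u,\mathrm r})\mathbf C_{\check{\mathbf h}_{\mathrm r}\check{\mathbf h}_{\mathrm r}}+\rho_{\mathrm t}\varepsilon_{\mathbf v}(1-\varepsilon_{u,\mathrm t})\mathbf C_{\check{\mathbf h}_{\mathrm t}\check{\mathbf h}_{\mathrm t}}+\sum_{\mathrm i\in\{\mathrm r,\mathrm t\}}\rho_{\mathrm i}(1-\varepsilon_{\mathbf v})\Big(\varrho_{\mathbf A_{\mathrm i}}\varrho_{\mathbf g_{\mathrm i}}\frac{(1+\kappa_{\mathbf g_{\mathrm i}}+\kappa_{\mathbf A_{\mathrm i}})N_{\mathrm i}}{(1+\kappa_{\mathbf A_{\mathrm i}})(1+\kappa_{\mathbf g_{\mathrm i}})}+\varrho_{\mathbf b_{\mathrm i}}+\varrho_{\mathbf A_{\mathrm i}}\varrho_{\mathbf g_{\mathrm i}}\frac{\kappa_{\mathbf A_{\mathrm i}}\kappa_{\mathbf g_{\mathrm i}}|\overline{\mathbf a}^{(\mathrm{IOS})\mathrm H}_{\mathrm i}\mathbf\Theta_{\mathrm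 i}\overline{\mathbf g}_{\mathrm i}|^2}{(1+\kappa_{\mathbf A_{\mathrm i}})(1+\kappa_{\mathbf g_{\mathrm i}})}\Big)\mathbf I_M+\sigma_w^2\mathbf I_M.$ *)

(* Defs.v *)
From HB Require Import structures.
From mathcomp Require Import all_boot all_order all_algebra.
From mathcomp Require Import all_classical all_reals all_analysis.
From mathcomp Require Import complex.

Set Implicit Arguments.
Unset Strict Implicit.
Unset Printing Implicit Defensive.

Import Order.TTheory GRing.Theory Num.Theory.

Local Open Scope classical_set_scope.
Local Open Scope ring_scope.
Local Open Scope complex_scope.

Inductive user := Ur | Ut.
Definition other (i : user) : user := if i is Ur then Ut else Ur.
Definition ucode (i : user) : nat := if i is Ur then 0 else 1.

Record sysparams (R : realType) := SysParams {
  M : nat;                                  (* AP antennas *)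
  Nx : user -> nat;  Ny : user -> nat;      (* IOS elements N_i = Nx i * Ny i *)
  lambda : R; d0 : R; deltax : R; deltay : R;
  phi : user -> R; varphi : user -> R; omega : user -> R; varpi : user -> R;
  psi : user -> R;
  rhoA : user -> R; rhog : user -> R; rhob : user -> R;   (* path losses *)
  kapA : user -> R; kapg : user -> R;                    (* Rician factors *)
  theta : forall i : user, 'I_(Nx i * Ny i) -> R;         (* IOS phases *)
  epsv : R; epsu : user -> R;                            (* hardware quality *)
  rho : user -> R;                                       (* transmit powers *)
  sigw2 : R;                                             (* noise variance *)
  K : nat                                                (* pilot length *)
}.
Arguments theta {R} s i _.

Section Defs.
Variable R : realType.
Local Notation C := R[i].
Local Notation cR x := (real_complex R x).

Definition Nel (p : sysparams R) (i : user) : nat := Nx p i * Ny p i.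

Definition expi (t : R) : C := cos t +i* sin t.

Definition hT m n (A : 'M[C]_(m, n)) : 'M[C]_(n, m) := (map_mx conjc A)^T.

Definition hadam n (a b : 'cV[C]_n) : 'cV[C]_n := \col_k (a k 0 * b k 0).

(** IOS steering-type vector; entry k <-> (n_x, n_y) = (k %/ Ny, k %% Ny). *)
Definition ios_vec (p : sysparams R) (i : user) (a b : R) : 'cV[C]_(Nel p i) :=
  \col_(k < Nel p i)
    expi (2 * pi / lambda p *
          (deltax p * (k %/ Ny p i)%:R * sin a * cos b
           + deltay p * (k %% Ny p i)%:R * cos a)).

Definition gbar p i := ios_vec p i (phi p i) (varphi p i).
Definition abarIOS p i := ios_vec p i (omega p i) (varpi p i).
(** m-th entry (1-based) exp(j 2pi/lambda d0 (m-1) cos psi); here m is 0-based *)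
Definition abarAP (p : sysparams R) (i : user) : 'cV[C]_(M p) :=
  \col_(m < M p) expi (2 * pi / lambda p * d0 p * m%:R * cos (psi p i)).
Definition Abar p i : 'M[C]_(M p, Nel p i) := abarAP p i *m hT (abarIOS p i).
Definition Theta p i : 'M[C]_(Nel p i) :=
  diag_mx (\row_(n < Nel p i) expi (theta p i n)).

Definition gainIOS p i : C :=
  let z := (hT (abarIOS p i) *m Theta p i *m gbar p i) 0 0 in z * conjc z.

Section Random.
Variables (d : measure_display) (T : measurableType d) (P : probability T R).

Definition mutually_independent (Z : nat -> T -> R) : Prop :=
  forall s : seq nat, uniq s ->
  forall B : nat -> set R, (forall k, measurable (B k)) ->
    P (\bigcap_(k in [set` s]) (Z k @^-1` B k)) =
    (\prod_(k <- s) P (Z k @^-1` B k))%E.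

Definition std_normal_rv (X : T -> R) : Prop :=
  measurable_fun setT X /\
  forall B : set R, measurable B -> P (X @^-1` B) = normal_prob 0 1 B.

Variable Z : nat -> T -> R.
Variable p : sysparams R.

(** CN(0,1) variable labelled by the code c: real and imaginary parts are the
    independent N(0,1/2) variables Z(code (c ++ [0])) / sqrt 2 and
    Z(code (c ++ [1])) / sqrt 2. Distinct labels use distinct Z's. *)
Definition cgauss (c : seq nat) (w : T) : C :=
  (Z (CodeSeq.code (rcons c 0)) w / Num.sqrt 2)
    +i* (Z (CodeSeq.code (rcons c 1)) w / Num.sqrt 2).

(* labels: 0 = b_i, 1 = g~_i, 2 = A~_i, 3 = u, 4 = v, 5 = w *)
Definition bvec i w : 'cV[C]_(M p) := \col_(m < M p) cgauss [:: 0; ucode i; nat_of_ord m] w.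
Definition gtil i w : 'cV[C]_(Nel p i) :=
  \col_(n < Nel p i) cgauss [:: 1; ucode i; nat_of_ord n] w.
Definition Atil i w : 'M[C]_(M p, Nel p i) :=
  \matrix_(m < M p, n < Nel p i) cgauss [:: 2; ucode i; nat_of_ord m; nat_of_ord n] w.
(** impairments / noise in the observation x_o (o = observing user) *)
Definition uimp (o j : user) w : C := cgauss [:: 3; ucode o; ucode j] w.
Definition vimp (o j : user) w : 'cV[C]_(M p) :=
  \col_(m < M p) cgauss [:: 4; ucode o; ucode j; nat_of_ord m] w.
Definition wnoise (o : user) w : 'cV[C]_(M p) :=
  cR (Num.sqrt (sigw2 p)) *: \col_(m < M p) cgauss [:: 5; ucode o; nat_of_ord m] w.

Definition gvec i w : 'cV[C]_(Nel p i) :=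
  cR (Num.sqrt (kapg p i / (1 + kapg p i))) *: gbar p i
  + cR (Num.sqrt (1 / (1 + kapg p i))) *: gtil i w.
Definition Amat i w : 'M[C]_(M p, Nel p i) :=
  cR (Num.sqrt (kapA p i / (1 + kapA p i))) *: Abar p i
  + cR (Num.sqrt (1 / (1 + kapA p i))) *: Atil i w.

Definition hch i w : 'cV[C]_(M p) :=
  cR (Num.sqrt (rhoA p i * rhog p i)) *: (Amat i w *m Theta p i *m gvec i w)
  + cR (Num.sqrt (rhob p i)) *: bvec i w.

Definition xobs (i : user) w : 'cV[C]_(M p) :=
  let j := other i in
  cR (Num.sqrt ((K p)%:R * rho p i * epsv p * epsu p i)) *: hch i w
  + (cR (Num.sqrt (rho p i * epsv p * (1 - epsu p i))) * uimp i i w) *: hch i w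
  + (cR (Num.sqrt (rho p j * epsv p * (1 - epsu p j))) * uimp i j w) *: hch j w
  + cR (Num.sqrt (rho p i * (1 - epsv p))) *: hadam (hch i w) (vimp i i w)
  + cR (Num.sqrt (rho p j * (1 - epsv p))) *: hadam (hch j w) (vimp i j w)
  + wnoise i w.

Definition cE (f : T -> C) : C :=
  Rintegral P setT (fun w => complex.Re (f w)) +i* Rintegral P setT (fun w => complex.Im (f w)).
Definition mvec n (X : T -> 'cV[C]_n) : 'cV[C]_n := \col_k cE (fun w => X w k 0).
Definition cov n m (X : T -> 'cV[C]_n) (Y : T -> 'cV[C]_m) : 'M[C]_(n, m) :=
  \matrix_(a, b) cE (fun w => (X w a 0 - mvec X a 0) * conjc (Y w b 0 - mvec Y b 0)).

Definition Chx i := cov (hch i) (xobs i).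
Definition Cxx i := cov (xobs i) (xobs i).
Definition hhat i w : 'cV[C]_(M p) :=
  mvec (hch i) + Chx i *m invmx (Cxx i) *m (xobs i w - mvec (xobs i)).
Definition Chhat i := Chx i *m invmx (Cxx i) *m hT (Chx i).
Definition Cerr i := cov (hch i) (hch i) - Chhat i.

Definition diagterm i : C :=
  cR (rho p i * (1 - epsv p)) *
  ( cR (rhoA p i * rhog p i * (1 + kapg p i + kapA p i) * (Nel p i)%:R
        / ((1 + kapA p i) * (1 + kapg p i)))
    + cR (rhob p i)
    + cR (rhoA p i * rhog p i * kapA p i * kapg p i
        / ((1 + kapA p i) * (1 + kapg p i))) * gainIOS p i).
Definition Rmat : 'M[C]_(M p) :=
  cR (rho p Ur * epsv p * (1 - epsu p Ur)) *: Cerr Ur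
  + cR (rho p Ut * epsv p * (1 - epsu p Ut)) *: Cerr Ut
  + (diagterm Ur + diagterm Ut + cR (sigw2 p))%:M.

Definition quadR a b w : C := (hT (hhat a w) *m invmx Rmat *m hhat b w) 0 0.

Definition zeta i w : R :=
  let j := other i in
  complex.Re (quadR i i w
      - cR (rho p j * epsv p) * quadR i j w * quadR j i w
        / (1 + cR (rho p j * epsv p) * quadR j j w)).

Definition log2 (x : R) : R := ln x / ln 2.

Definition Rerg i : \bar R :=
  (\int[P]_w
     (log2 (1 + rho p i * epsv p * epsu p i * zeta i w
                / (1 + rho p i * epsv p * (1 - epsu p i) * zeta i w)))%:E)%E.
End Random.

Definition eta (p : sysparams R) i : R :=
  rhoA p i * rhog p i
    * (kapA p i * kapg p i * (Nel p i)%:R ^+ 2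
       + (1 + kapg p i + kapA p i) * (Nel p i)%:R)
    / ((1 + kapA p i) * (1 + kapg p i))
  + rhob p i.

Definition Rddot (p : sysparams R) i : R :=
  log2 (1 + rho p i * epsv p * epsu p i * (M p)%:R * eta p i
            / (rho p i * epsv p * (1 - epsu p i) * (M p)%:R * eta p i
               + rho p Ur * (1 - epsv p) * eta p Ur
               + rho p Ut * (1 - epsv p) * eta p Ut
               + sigw2 p)).

End Defs.

(* Main.v *)
Require Import Defs.
From HB Require Import structures.
From mathcomp Require Import all_boot all_order all_algebra.
From mathcomp Require Import all_classical all_reals all_analysis.
From mathcomp Require Import complex measurable_realfun ring lra.
Import Order.TTheory GRing.Theory Num.Theory.
Local Open Scope classical_set_scope.
Local Open Scope ring_scope.

(** [R >= D I] with [D = sum_i rho_i (1 - eps_v) eta_i + sigma_w^2], because an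
    LMMSE error covariance is positive semidefinite.  Hence
    [0 <= zeta_i <= hhat_i^H R^-1 hhat_i <= |hhat_i|^2 / D], the first bound being
    Cauchy-Schwarz for [R^-1].  Moreover [E |hhat_i|^2 <= E |h_i|^2 <= M eta_i],
    so the concave rate function, bounded by its tangent at [M eta_i / D], has
    expectation at most its value there.

    The entries of [h_i] and [x_i] are polynomials in independent standard
    normal variables, whose moments are all finite; expectations of products of
    polynomials in disjoint sets of variables factor.  Only [E Z = 0] and
    [0 < E Z^2 <= 1] are needed about the normal law, and these follow from
    [E exp(t Z) = exp(t^2 / 2)]. *)

(** The two bounds on E Z^2 serve different ends. Positivity makes [Cxx] invertible, because the
    thermal noise adds a positive multiple of sigma_w^2 I to it; invertibility is what identifies
    [Cerr] with the second moment of the estimation error. The bound by 1 enters only in E |h_i|^2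
    <= M eta_i, and a one-sided estimate is enough there because the tangent has nonnegative slope.
    Both bounds come from integrating elementary inequalities between powers and exponentials and
    taking t small. The obstacle is that neither h_i nor x_i is Gaussian: the cascaded channel
    multiplies two Gaussian families, and the impairments multiply the channel again. Conditioning
    on one family is therefore replaced by bookkeeping: each polynomial carries the set of labels it
    may involve, and second moments are computed by splitting off one fresh family at a time. The
    estimate is affine in x_i, hence still a polynomial, so every LMMSE identity reduces to
    linearity of the expectation. *)

(** * Change of variables with a weight *)

Section weighted_pushforward.
Local Open Scope ereal_scope.
Context (d1 d2 : measure_display) (T : measurableType d1)
  (U : measurableType d2) (R : realType).
Variables (mu : {measure set T -> \bar R}) (nu : {measure set U -> \bar R}).
Variables (X : T -> U) (g : T -> R).
Hypotheses (mX : measurable_fun setT X) (mg : measurable_fun setT g).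
Hypothesis g0 : forall w, (0 <= g w)%R.
Hypothesis nuE : forall B, measurable B ->
  \int[mu]_w ((\1_B (X w) * g w)%R)%:E = nu B.

Import HBNNSimple.

(** The hypothesis [nuE] is the case of indicators; simple functions and monotone convergence on
    both sides give the rest. It has two uses: with [X] the identity and [g] a density it rewrites a
    normal integral as a Lebesgue integral, and with [X] one of the variables and [g] the product of
    the other factors it splits that variable off an expectation. *)
Lemma ge0_integral_weighted_pushforward (f : U -> \bar R) :
  (forall x, 0 <= f x) -> measurable_fun setT f ->
  \int[mu]_w (f (X w) * (g w)%:E) = \int[nu]_x f x.
Proof.
move=> f0 mf; pose h := nnsfun_approx measurableT mf.
have mhX n : measurable_fun setT (fun w => h n (X w)).
  exact: (measurableT_comp (measurable_funP (h n)) mX).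
have -> : \int[nu]_x f x = lim (\int[nu]_x (EFin \o h n) x @[n --> \oo]).
  have fE x : f x = lim ((EFin \o h n) x @[n --> \oo]).
    by apply/esym/cvg_lim => //; exact: cvg_nnsfun_approx.
  under eq_integral => x _ do rewrite fE.
  apply: monotone_convergence => //.
  - by move=> n; exact/measurable_EFinP/measurable_funP.
  - by move=> n x _ /=; rewrite lee_fin.
  - by move=> x _ a b ab; rewrite lee_fin; exact/lefP/nd_nnsfun_approx.
have -> : \int[mu]_w (f (X w) * (g w)%:E) =
    lim (\int[mu]_w ((h n (X w))%:E * (g w)%:E) @[n --> \oo]).
  have fg w : f (X w) * (g w)%:E =
      lim ((h n (X w))%:E * (g w)%:E @[n --> \oo]).
    apply/esym/cvg_lim => //; apply: cvgeZr => //.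
    exact: (@cvg_nnsfun_approx _ _ _ _ measurableT _ mf (fun x _ => f0 x)).
  under eq_integral => w _ do rewrite fg.
  apply: monotone_convergence => [//| | |].
  - by move=> n; apply: emeasurable_funM; exact/measurable_EFinP.
  - by move=> n w _ /=; rewrite mule_ge0 ?lee_fin.
  - move=> w _ a b ab /=; rewrite lee_wpmul2r ?lee_fin//.
    exact/lefP/nd_nnsfun_approx.
suff suf n : \int[mu]_w ((h n (X w))%:E * (g w)%:E) =
    \int[nu]_x (EFin \o h n) x.
  by under eq_fun do rewrite suf.
transitivity (\int[nu]_x
   (\sum_(y \in range (h n)) (y * \1_(h n @^-1` [set y]) x)%:E)); last first.
  by apply: eq_integral => t _; rewrite /= fimfunE -fsumEFin.
rewrite ge0_integral_fsum//; last 2 first.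
  - move=> y; apply/measurable_EFinP.
    by apply: measurable_funM => //.
  - by move=> m y _; exact: nnfun_muleindic_ge0.
transitivity (\int[mu]_w (\sum_(y \in range (h n))
    (y * \1_(h n @^-1` [set y]) (X w))%:E * (g w)%:E)).
  apply: eq_integral => w _.
  rewrite -ge0_mule_fsuml => [|y]; last exact: nnfun_muleindic_ge0.
  by rewrite fsumEFin // -(fimfunE _ (X w)).
have mi y : measurable_fun setT
    (fun w => (\1_(h n @^-1` [set y]) (X w) : R)).
  by apply: (measurableT_comp _ mX) => //.
rewrite ge0_integral_fsum//; last 2 first.
  - move=> y; apply: emeasurable_funM; apply/measurable_EFinP => //.
    by apply: measurable_funM.
  - by move=> m y _; rewrite mule_ge0 ?nnfun_muleindic_ge0 ?lee_fin.
apply: eq_fsbigr => r rhn.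
have r0 : (0 <= r)%R by move: rhn; rewrite inE => -[t _ <-].
under [RHS]eq_integral do rewrite EFinM.
rewrite integralZl_indic_nnsfun => //.
under eq_integral do rewrite EFinM -muleA.
rewrite ge0_integralZl//.
- rewrite integral_indic// setIT -nuE//.
- by apply: emeasurable_funM; exact/measurable_EFinP.
- by move=> t _; rewrite mule_ge0 ?lee_fin.
Qed.

End weighted_pushforward.

(** * Moments of the standard normal law *)

Section std_normal_moments.
Context {R : realType}.
Local Notation N := (normal_prob (0 : R) 1).
Local Notation mu := (@lebesgue_measure R).

Lemma ge0_integral_std_normal (f : R -> R) : measurable_fun setT f ->
  (forall x, 0 <= f x) ->
  (\int[N]_x (f x)%:E = \int[mu]_x (f x * normal_pdf 0 1 x)%:E)%E.
Proof.
move=> mf f0.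
rewrite -(@ge0_integral_weighted_pushforward _ _ _ _ R mu N (@id R)
  (normal_pdf 0 1))//.
- exact: measurable_normal_pdf.
- by move=> x; exact: normal_pdf_ge0.
- move=> B mB; rewrite /normal_prob /= [RHS]integral_mkcond.
  apply: eq_integral => x _; rewrite patchE indicE.
  by case: ifP => _; rewrite ?mul1r ?mul0r.
- exact/measurable_EFinP.
Qed.

(** Completing the square: exp(t x) times the standard density is exp(t^2 / 2) times the normal
    density of mean [t], which has integral 1. *)
Lemma mgf_std_normal (t : R) :
  (\int[N]_x (expR (t * x))%:E = (expR (t ^+ 2 / 2))%:E)%E.
Proof.
rewrite ge0_integral_std_normal; last 2 first.
- by apply: measurableT_comp => //; apply: measurable_funM.
- by move=> x; exact: expR_ge0.
transitivity (\int[mu]_x ((expR (t ^+ 2 / 2))%:E * (normal_pdf t 1 x)%:E))%E.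
  apply: eq_integral => x _.
  rewrite -EFinM !normal_pdfE ?oner_neq0//; congr EFin.
  rewrite mulrCA [RHS]mulrCA; congr (_ * _).
  rewrite /normal_fun -!expRD; congr expR.
  by field.
rewrite integralZl//; last exact: integrable_normal_pdf.
by rewrite integral_normal_pdf mule1.
Qed.

Lemma integrable_expR_std_normal (t : R) :
  N.-integrable setT (EFin \o (fun x => expR (t * x))).
Proof.
apply/integrableP; split.
  apply/measurable_EFinP.
  by apply: measurableT_comp => //; apply: measurable_funM.
under eq_integral => x _ do rewrite /= ger0_norm ?expR_ge0//.
by rewrite mgf_std_normal ltry.
Qed.

Lemma Rintegral_expR_std_normal (t : R) :
  Rintegral N setT (fun x => expR (t * x)) = expR (t ^+ 2 / 2).
Proof. by rewrite /Rintegral mgf_std_normal. Qed.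

(** For a positive exponent n, |x|^n <= n! exp |x| <= n! (exp x + exp (- x)), and both exponentials
    are integrable. *)
Lemma integrable_exprn_std_normal (n : nat) :
  N.-integrable setT (EFin \o (fun x : R => x ^+ n)).
Proof.
have mX : measurable_fun setT (fun x : R => x ^+ n) by exact: measurable_funX.
case: n mX => [|n] mX.
  rewrite (_ : _ \o _ = EFin \o cst 1) //.
  exact: finite_measure_integrable_cst.
pose F (x : R) := n.+1`!%:R * (expR (1 * x) + expR (-1 * x)).
apply: (@le_integrable _ _ _ N setT measurableT _ (EFin \o F)).
- exact/measurable_EFinP.
- move=> x _; rewrite /= !lee_fin normrX.
  rewrite [leRHS]ger0_norm; last first.
    by rewrite mulr_ge0 ?ler0n// addr_ge0 ?expR_ge0.
  have h : `|x| ^+ n.+1 <= n.+1`!%:R * expR `|x|.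
    have := expR_ge1Dxn n (normr_ge0 x).
    rewrite -lerBrDl ler_pdivrMr ?ltr0n ?fact_gt0// => /le_trans; apply.
    by rewrite mulrC ler_wpM2l ?ler0n// gerBl.
  apply: (le_trans h); rewrite ler_wpM2l ?ler0n//.
  rewrite mul1r mulN1r; have [x0|x0] := leP 0 x.
    by rewrite (ger0_norm x0) lerDl expR_ge0.
  by rewrite (ltr0_norm x0) lerDr expR_ge0.
- rewrite (_ : _ \o _ = fun x => ((n.+1`!%:R)%:E *
     ((EFin \o (fun x => expR (1 * x))) \+ (EFin \o (fun x => expR (- 1 * x)))) x)%E)//.
  apply: integrableZl => //.
  by apply: integrableD => //; exact: integrable_expR_std_normal.
Qed.

Lemma integrable_cst_std_normal (r : R) : N.-integrable setT (EFin \o cst r).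
Proof. exact: finite_measure_integrable_cst. Qed.

Lemma std_normal_setT : N [set: R] = 1%E.
Proof. exact: (@probability_setT _ _ _ N). Qed.

Lemma Rintegral_cst_std_normal (r : R) : Rintegral N setT (fun=> r) = r.
Proof.
rewrite (Rintegral_cst N measurableT r).
rewrite -[RHS]mulr1; congr (_ * _); rewrite -[RHS]/(fine 1%E).
by congr fine; exact: std_normal_setT.
Qed.

(** Integrating 1 + t x <= exp(t x) gives t m <= exp(t^2 / 2) - 1. The right side is of order t^2,
    so small t of either sign forces m = 0. *)
Lemma std_normal_mean : Rintegral N setT (fun x : R => x) = 0.
Proof.
have i1 : N.-integrable setT (EFin \o (fun x : R => x)).
  exact: (integrable_exprn_std_normal 1).
set m := Rintegral _ _ _.
have key t : t * m <= expR (t ^+ 2 / 2) - 1.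
  rewrite lerBrDl -Rintegral_expR_std_normal.
  rewrite -[X in X + _](Rintegral_cst_std_normal 1) /m -RintegralZl//.
  rewrite -RintegralD//; last 2 first.
    exact: integrable_cst_std_normal.
    by have := integrableZl measurableT t i1.
  apply: le_Rintegral => //.
  - have := integrableD measurableT (integrable_cst_std_normal 1)
      (integrableZl measurableT t i1); exact.
  - exact: integrable_expR_std_normal.
  - by move=> x _; exact: expR_ge1Dx.
(* With s = t^2 / 2 <= 1/2, the inequality exp(- s) >= 1 - s yields exp s <= 1 / (1 - s) <= 1 + 2
   s. *)
have key2 t : `|t| <= 1 -> t * m <= t ^+ 2.
  move=> t1; apply: (le_trans (key t)).
  have t2 : t ^+ 2 <= 1 by rewrite -real_normK ?num_real// exprn_ile1.
  have t0 : 0 <= t ^+ 2 by exact: sqr_ge0.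
  have := expR_ge1Dx (- (t ^+ 2 / 2)); rewrite expRN => h.
  set e := expR _ in h *; have e0 : 0 < e by exact: expR_gt0.
  have : e * (1 + - (t ^+ 2 / 2)) <= 1.
    by rewrite -(@ler_pdivlMl _ e)// mulr1.
  by nra.
apply/eqP; rewrite eq_le; apply/andP; split.
- rewrite leNgt; apply/negP => m0.
  (* Cancelling [t] in [key2] gives m <= t <= m / 2, absurd for m > 0; the minimum with 1 keeps [t]
     in the range of [key2]. *)
  pose t := Num.min 1 (m / 2).
  have t0 : 0 < t by rewrite lt_min ltr01 divr_gt0.
  have := key2 t; rewrite ger0_norm ?(ltW t0)// ge_min lexx => /(_ isT).
  rewrite expr2 ler_pM2l// le_min => /andP[_]; lra.
- rewrite leNgt; apply/negP => m0.
  pose t := Num.min 1 (- m / 2).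
  have t0 : 0 < t by rewrite lt_min ltr01 divr_gt0// oppr_gt0.
  have := key2 (- t); rewrite normrN ger0_norm ?(ltW t0)// ge_min lexx => /(_ isT).
  rewrite sqrrN expr2 mulNr -mulrN ler_pM2l// le_min => /andP[_]; lra.
Qed.

(** The mean value theorem gives 2 u <= exp u - exp (- u) for u >= 0, the derivative of the
    difference being exp x + exp (- x) - 2 >= 0. Squaring this at u = y / 2 gives the claim, since
    (exp u - exp (- u))^2 = exp y + exp (- y) - 2. *)
Lemma cosh_ge (y : R) : 2 + y ^+ 2 <= expR y + expR (- y).
Proof.
have h (u : R) : 0 <= u -> 2 * u <= expR u - expR (- u).
  move=> u0; pose g x : R := expR x - expR (- x) - 2 * x.
  have dg (x : R) : is_derive x 1 g (expR x + expR (- x) - 2).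
    by rewrite /g; apply: is_derive_eq; rewrite /GRing.scale/=; ring.
  suff : g 0 <= g u by rewrite /g oppr0 subrr mulr0 subr0 subr_ge0.
  have [->//|un0] := eqVneq u 0.
  have up : 0 < u by rewrite lt_def un0.
  have [c cu] : exists2 c, c \in `]0, u[%R &
      g u - g 0 = (expR c + expR (- c) - 2) * (u - 0).
    apply: (@MVT _ g (fun c => expR c + expR (- c) - 2)) => //.
    by apply: derivable_within_continuous => x _; have [] := dg x.
  move=> e; rewrite -subr_ge0 e mulr_ge0 ?subr0//.
  rewrite expRN; set a := expR c; have a0 : 0 < a by exact: expR_gt0.
  have : 0 <= (a - 1) ^+ 2 / a by rewrite divr_ge0 ?sqr_ge0// ltW.
  by rewrite (_ : _ / a = a + a^-1 - 2)//; field; rewrite gt_eqF.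
wlog y0 : y / 0 <= y.
  move=> H; have [/H//|/ltW y0] := leP 0 y.
  by have := H (- y); rewrite sqrrN opprK addrC [_ + expR y]addrC; apply; rewrite oppr_ge0.
have := h (y / 2); rewrite divr_ge0// => /(_ isT).
have -> : expR y = expR (y / 2) ^+ 2 by rewrite expr2 -expRD; congr expR; field.
have -> : expR (- y) = expR (- (y / 2)) ^+ 2 by rewrite expr2 -expRD; congr expR; field.
have : expR (y / 2) * expR (- (y / 2)) = 1 by rewrite expRxMexpNx_1.
set a := expR _; set b := expR (- _) => ab.
rewrite mulrCA divff// mulr1 => le1.
have : y ^+ 2 <= (a - b) ^+ 2 by rewrite ler_sqr// nnegrE// (le_trans y0).
rewrite sqrrB ab; lra.
Qed.

(** Integrating [cosh_ge] at t x gives t^2 m <= 2 (exp(t^2 / 2) - 1), whose right side is t^2 to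
    leading order. *)
Lemma std_normal_var_le1 : Rintegral N setT (fun x : R => x ^+ 2) <= 1.
Proof.
have i2 := integrable_exprn_std_normal 2.
set m := Rintegral _ _ _.
have key t : t ^+ 2 * m <= 2 * (expR (t ^+ 2 / 2) - 1).
  have -> : 2 * (expR (t ^+ 2 / 2) - 1) =
      Rintegral N setT (fun x => expR (t * x) + expR (- t * x)) - 2.
    rewrite RintegralD//; try exact: integrable_expR_std_normal.
    by rewrite !Rintegral_expR_std_normal sqrrN; ring.
  rewrite lerBrDl -[X in X + _](Rintegral_cst_std_normal 2).
  rewrite /m -RintegralZl// -RintegralD//; last 2 first.
    exact: integrable_cst_std_normal.
    by have := integrableZl measurableT (t ^+ 2) i2.
  apply: le_Rintegral => //.
  - have := integrableD measurableT (integrable_cst_std_normal 2)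
      (integrableZl measurableT (t ^+ 2) i2); exact.
  - have := integrableD measurableT (integrable_expR_std_normal t)
      (integrable_expR_std_normal (- t)); exact.
  - by move=> x _; rewrite -exprMn mulNr; exact: cosh_ge.
rewrite leNgt; apply/negP => m1.
have m0 : 0 < m by rewrite (lt_trans _ m1).
(* Put t^2 = 2 s. Since exp s <= 1 / (1 - s), [key] would give m (1 - s) <= 1, and this [s] is
   chosen to make m (1 - s) = (m + 1) / 2 > 1. *)
pose s := (m - 1) / (2 * m).
have s0 : 0 < s by rewrite divr_gt0 ?subr_gt0// mulr_gt0.
have ms : m * s = (m - 1) / 2 by rewrite /s; field; rewrite gt_eqF.
have := key (Num.sqrt (2 * s)); rewrite sqr_sqrtr; last by rewrite ltW// mulr_gt0.
rewrite (_ : 2 * s / 2 = s); last by field.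
have := expR_ge1Dx (- s); rewrite expRN.
set e := expR s; have e0 : 0 < e by exact: expR_gt0.
move=> h; have h2 : e * (1 + - s) <= 1 by rewrite -(@ler_pdivlMl _ e)// mulr1.
move=> h3.
have s1 : s < 1 by nra.
nra.
Qed.

(** If the integral vanished, x^2 would be zero almost everywhere and the law would sit on the point
    0, which has mass zero because the law has a density. *)
Lemma std_normal_var_gt0 : 0 < Rintegral N setT (fun x : R => x ^+ 2).
Proof.
rewrite lt_def Rintegral_ge0 ?andbT; last by move=> x _; exact: sqr_ge0.
apply/eqP => m0.
have i2 := integrable_exprn_std_normal 2.
have mX : measurable_fun setT (EFin \o (fun x : R => x ^+ 2)).
  by have /integrableP[] := i2.
have e0 : (\int[N]_x `|(EFin \o (fun x : R => x ^+ 2)%R) x| = 0)%E.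
  transitivity (\int[N]_x ((x ^+ 2)%R)%:E)%E.
    by apply: eq_integral => x _; rewrite gee0_abs// lee_fin sqr_ge0.
  have := integrable_fin_num measurableT i2 => /fineK <-.
  by move: m0; rewrite /Rintegral => ->.
have /(ae_eq_integral_abs N measurableT mX) [A [mA A0 sA]] := e0.
have : N [set: R] = 0%E.
  apply/eqP; rewrite eq_le measure_ge0 andbT.
  apply: (@le_trans _ _ (N (A `|` [set 0]))).
    apply: le_measure; rewrite ?inE//; first exact: measurableU.
    move=> x _; have [->|x0] := eqVneq x 0; first by right.
    left; apply: sA => /= H; have := H I => -[]; move/eqP.
    by rewrite expf_eq0 /= (negbTE x0).
  apply: (le_trans (measureU2 _ _ _)) => //.
  have NA : (N A <= 0)%E by rewrite A0.
  have N0 : (N [set 0%R] <= 0)%E by rewrite /normal_prob integral_set1.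
  rewrite -[leRHS]adde0; apply: leeD; [exact: NA|exact: N0].
by rewrite std_normal_setT => /eqP; rewrite onee_eq0.
Qed.

End std_normal_moments.

(** * Products of independent variables *)

Section independent_normals.
Context {R : realType} {d : measure_display} {T : measurableType d}.
Variables (P : probability T R) (Z : nat -> T -> R).
Hypothesis normalZ : forall k, std_normal_rv P (Z k).
Hypothesis indepZ : mutually_independent P Z.
Local Notation N := (normal_prob (0 : R) 1).
Local Notation EN f := (Rintegral N setT f).

Let mZ k : measurable_fun setT (Z k). Proof. by have [] := normalZ k. Qed.

Lemma prod_indic_bigcap (s : seq nat) (B : nat -> set R) (w : T) :
  \prod_(k <- s) \1_(B k) (Z k w) =
  \1_(\bigcap_(k in [set` s]) (Z k @^-1` B k)) w :> R.
Proof.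
elim: s => [|k s IH]; rewrite ?big_nil ?big_cons ?IH !indicE.
  by rewrite mem_set.
rewrite -natrM mulnb; congr (nat_of_bool _)%:R.
apply/idP/idP.
  move=> /andP[/set_mem Bk /set_mem Bs]; apply/mem_set => j /=.
  by rewrite inE => /orP[/eqP ->|js]//; exact: Bs.
move=> /set_mem Bs; apply/andP; split; apply/mem_set.
  by apply: (Bs k); rewrite /= mem_head.
by move=> j /= js; apply: Bs; rewrite /= inE js orbT.
Qed.

Lemma fin_num_std_normal (B : set R) : measurable B -> (N B \is a fin_num)%E.
Proof. by move=> mB; exact: (@fin_num_measure _ _ _ N). Qed.

Lemma integral_prod_indic (s : seq nat) (B : nat -> set R) : uniq s ->
  (forall k, measurable (B k)) ->
  (\int[P]_w (\prod_(k <- s) \1_(B k) (Z k w))%:E =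
   (\prod_(k <- s) fine (N (B k)))%:E)%E.
Proof.
move=> us mB.
have mZB k : measurable (Z k @^-1` B k).
  by rewrite -[X in measurable X]setTI; exact: mZ.
under eq_integral => w _ do rewrite prod_indic_bigcap.
rewrite integral_indic ?setIT//; last first.
  by apply: fin_bigcap_measurable => //; exact: finite_seq.
apply: etrans; first exact: indepZ us B mB.
rewrite -prodEFin; apply: eq_bigr => k _.
have [_ ->//] := normalZ k.
by rewrite fineK// fin_num_std_normal.
Qed.

Section nonnegative.
Variable f : nat -> R -> R.
Hypotheses (f0 : forall k x, 0 <= f k x)
  (mf : forall k, measurable_fun setT (f k))
  (intf : forall k, N.-integrable setT (EFin \o f k)).

Let EN_ge0 k : 0 <= EN (f k).
Proof. by apply: Rintegral_ge0. Qed.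

Let mfZ k : measurable_fun setT (fun w => f k (Z k w)).
Proof. exact: measurableT_comp. Qed.

(** The indicators over [s] make the induction on [t] work: moving the head [k] of [t] into [s] with
    an arbitrary Borel set shows that the remaining factors weight the law of [Z k] into a constant
    multiple of the normal law, and the weighted change of variables then replaces the indicator by
    [f k]. *)
Let integral_prod_indic_ge0 (t s : seq nat) (B : nat -> set R) :
  uniq (s ++ t) -> (forall k, measurable (B k)) ->
  (\int[P]_w (\prod_(k <- s) \1_(B k) (Z k w) *
              \prod_(k <- t) f k (Z k w))%:E =
   (\prod_(k <- s) fine (N (B k)) * \prod_(k <- t) EN (f k))%:E)%E.
Proof.
elim: t s B => [|k t IH] s B ust mB.
  rewrite big_nil mulr1 -integral_prod_indic//; last by rewrite cats0 in ust.
  by under eq_integral => w _ do rewrite big_nil mulr1.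
move: ust; rewrite -cat1s uniq_catCA /= => /andP[kst ut].
move: (kst); rewrite mem_cat negb_or => /andP[ks kt].
pose g w := \prod_(j <- s) \1_(B j) (Z j w) * \prod_(j <- t) f j (Z j w) : R.
pose c := \prod_(j <- s) fine (N (B j)) * \prod_(j <- t) EN (f j).
have c0 : 0 <= c.
  rewrite mulr_ge0// prodr_ge0// => j _.
  by rewrite fine_ge0// measure_ge0.
have mg : measurable_fun setT g.
  apply: measurable_funM; apply: measurable_prod => j _ //.
  exact: measurableT_comp.
have g0 w : 0 <= g w by rewrite mulr_ge0// prodr_ge0.
have gB A : measurable A ->
    (\int[P]_w (\1_A (Z k w) * g w)%:E = mscale (NngNum c0) N A)%E.
  (* The sets form one family indexed by all of [nat], so [A] is written in at [k]; the factors over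
     [s] are unaffected because [k] is not in [s]. *)
  move=> mA; pose B' j := if j == k then A else B j.
  have := IH (k :: s) B'; rewrite /= kst ut => /(_ isT).
  have mB' j : measurable (B' j) by rewrite /B'; case: eqP.
  move=> /(_ mB'); rewrite /mscale /= big_cons {2}/B' eqxx.
  have BE (F : nat -> set R -> R) :
      \prod_(j <- s) F j (B' j) = \prod_(j <- s) F j (B j).
    rewrite !big_seq; apply: eq_bigr => j js; rewrite /B'.
    by have [jk|//] := eqVneq j k; rewrite -jk js in ks.
  rewrite (BE (fun=> fine \o N)) /= -mulrA mulrC EFinM fineK; last first.
    exact: fin_num_std_normal.
  move=> <-; apply: eq_integral => w _.
  rewrite big_cons {1}/B' eqxx mulrA /g.
  by rewrite (BE (fun j A => \1_A (Z j w))).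
have := @ge0_integral_weighted_pushforward _ _ _ _ R P
  (mscale (NngNum c0) N) (Z k) g (mZ k) mg g0 gB (EFin \o f k).
move=> /(_ (fun x => f0 k x)) /(_ ((measurable_EFinP _ _).2 (mf k))) h.
transitivity (\int[P]_w ((EFin \o f k) (Z k w) * (g w)%:E))%E.
  apply: eq_integral => w _; rewrite big_cons /= -EFinM; congr EFin.
  by rewrite /g; ring.
rewrite h ge0_integral_mscale//=; last first.
  by move=> x _; rewrite lee_fin.
  exact: ((measurable_EFinP _ _).2 (mf k)).
rewrite big_cons mulrCA -/c mulrC [RHS]EFinM.
have <- : (\int[N]_x (f k x)%:E = (EN (f k))%:E)%E.
  by rewrite /Rintegral fineK//; exact: integrable_fin_num (intf k).
by [].
Qed.

Lemma integral_prod_ge0 (s : seq nat) : uniq s ->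
  (\int[P]_w (\prod_(k <- s) f k (Z k w))%:E =
   (\prod_(k <- s) EN (f k))%:E)%E.
Proof.
move=> us; have := @integral_prod_indic_ge0 s [::] (fun=> setT).
rewrite /= us big_nil mul1r => /(_ isT) <- //.
by apply: eq_integral => w _; rewrite big_nil mul1r.
Qed.

End nonnegative.

Section signed.
Variable f : nat -> R -> R.
Hypotheses (mf : forall k, measurable_fun setT (f k))
  (intf : forall k, N.-integrable setT (EFin \o f k)).

Lemma integrable_prod (s : seq nat) : uniq s ->
  P.-integrable setT (EFin \o (fun w => \prod_(k <- s) f k (Z k w))).
Proof.
move=> us; apply/integrableP; split.
  apply/measurable_EFinP; apply: measurable_prod => k _.
  exact: measurableT_comp.
rewrite (eq_integral (fun w => (\prod_(k <- s) `|f k (Z k w)|)%:E)); last first.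
  by move=> w _; rewrite /= normr_prod.
rewrite (@integral_prod_ge0 (fun k x => `|f k x|))// ?ltry// => k.
- exact: measurableT_comp.
- exact: (integrable_norm (intf k)).
Qed.
End signed.

(** Same induction with nonnegative functions instead of indicators over [s]: the head [f k] is
    split into its positive and negative parts, each of which can join the nonnegative factors, and
    the two results are subtracted. *)
Let Rintegral_prod_mixed (t s : seq nat) (F f : nat -> R -> R) :
  (forall k x, 0 <= F k x) ->
  (forall k, measurable_fun setT (F k)) ->
  (forall k, N.-integrable setT (EFin \o F k)) ->
  (forall k, measurable_fun setT (f k)) ->
  (forall k, N.-integrable setT (EFin \o f k)) ->
  uniq (s ++ t) ->
  Rintegral P setT (fun w => \prod_(k <- s) F k (Z k w) *
                             \prod_(k <- t) f k (Z k w)) =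
  \prod_(k <- s) EN (F k) * \prod_(k <- t) EN (f k).
Proof.
elim: t s F => [|k t IH] s F F0 mF iF mf intf ust.
  rewrite /Rintegral (eq_integral (fun w => (\prod_(k <- s) F k (Z k w))%:E)); last first.
    by move=> w _; rewrite big_nil mulr1.
  by rewrite integral_prod_ge0// ?big_nil ?mulr1//; rewrite cats0 in ust.
move: ust; rewrite -cat1s uniq_catCA /= => /andP[kst ut].
move: (kst); rewrite mem_cat negb_or => /andP[ks kt].
pose G (h : R -> R) j := if j == k then h else F j.
have GE (h : R -> R) (H : nat -> (R -> R) -> R) :
    \prod_(j <- s) H j (G h j) = \prod_(j <- s) H j (F j).
  rewrite !big_seq; apply: eq_bigr => j js; rewrite /G.
  by have [jk|//] := eqVneq j k; rewrite -jk js in ks.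
have key (h : R -> R) : (forall x, 0 <= h x) -> measurable_fun setT h ->
    N.-integrable setT (EFin \o h) ->
    Rintegral P setT (fun w => h (Z k w) * (\prod_(j <- s) F j (Z j w) *
                             \prod_(j <- t) f j (Z j w))) =
    EN h * (\prod_(j <- s) EN (F j) * \prod_(j <- t) EN (f j)) /\
    P.-integrable setT (EFin \o (fun w => h (Z k w) *
      (\prod_(j <- s) F j (Z j w) * \prod_(j <- t) f j (Z j w)))).
  move=> h0 mh ih.
  have G0 j x : 0 <= G h j x by rewrite /G; case: eqP.
  have mG j : measurable_fun setT (G h j) by rewrite /G; case: eqP.
  have iG j : N.-integrable setT (EFin \o G h j) by rewrite /G; case: eqP.
  split.
    have := IH (k :: s) (G h) G0 mG iG mf intf; rewrite /= kst ut => /(_ isT).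
    rewrite big_cons {2}/G eqxx (GE h (fun j h => EN h)) mulrA => <-.
    apply: eq_Rintegral => w _.
    by rewrite big_cons {1}/G eqxx (GE h (fun j h => h (Z j w))) !mulrA.
  (* [integrable_prod] takes a single family, so the factors over [s] and [t] are glued together;
     this is consistent because [s] and [t] are disjoint. Integrability of the two halves is what
     permits their subtraction. *)
  pose G' j := if j \in t then f j else G h j.
  have mG' j : measurable_fun setT (G' j) by rewrite /G'; case: ifP.
  have iG' j : N.-integrable setT (EFin \o G' j) by rewrite /G'; case: ifP.
  have := @integrable_prod G' mG' iG' (k :: s ++ t); rewrite /= kst ut => /(_ isT).
  congr (integrable _ _ _); apply/funext => w /=; congr EFin.
  rewrite big_cons big_cat /= {1}/G' (negbTE kt) {1}/G eqxx; congr (_ * (_ * _)).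
    rewrite -(GE h (fun j h => h (Z j w))).
    rewrite !big_seq; apply: eq_bigr => j js; rewrite /G' ifF//.
    apply/negP => jt; move: ut; rewrite cat_uniq => /and3P[_ /hasPn /(_ _ jt)].
    by rewrite /= js.
  by rewrite !big_seq; apply: eq_bigr => j jt; rewrite /G' jt.
have [kp ip] : _ /\ _ := key (f k)^\+ (fun x => funrpos_ge0 _ x)
  (measurable_funrpos (mf k)) (integrable_funrpos measurableT (intf k)).
have [kn in_] : _ /\ _ := key (f k)^\- (fun x => funrneg_ge0 _ x)
  (measurable_funrneg (mf k)) (integrable_funrneg measurableT (intf k)).
have fE x : f k x = (f k)^\+ x - (f k)^\- x
  by rewrite /funrpos /funrneg /Num.max; do 2 case: ifPn; rewrite -?leNgt; lra.
rewrite (@eq_Rintegral _ _ _ _ _ (fun w =>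
  (f k)^\+ (Z k w) * (\prod_(j <- s) F j (Z j w) * \prod_(j <- t) f j (Z j w)) -
  (f k)^\- (Z k w) * (\prod_(j <- s) F j (Z j w) * \prod_(j <- t) f j (Z j w)))); last first.
  by move=> w _; rewrite big_cons fE; ring.
rewrite RintegralB// kp kn big_cons.
have -> : EN (f k) = EN (f k)^\+ - EN (f k)^\-.
  have ip' := integrable_funrpos measurableT (intf k).
  have in' := integrable_funrneg measurableT (intf k).
  rewrite -RintegralB//.
  by apply: eq_Rintegral => x _; exact: fE.
by ring.
Qed.

Lemma Rintegral_prod (s : seq nat) (f : nat -> R -> R) :
  (forall k, measurable_fun setT (f k)) ->
  (forall k, N.-integrable setT (EFin \o f k)) -> uniq s ->
  Rintegral P setT (fun w => \prod_(k <- s) f k (Z k w)) =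
  \prod_(k <- s) EN (f k).
Proof.
move=> mf intf us.
have := @Rintegral_prod_mixed s [::] (fun _ _ => 1) f.
rewrite us !big_nil mul1r => <- //.
- by apply: eq_Rintegral => w _; rewrite ?big_nil mul1r.
- by move=> k; exact: integrable_cst_std_normal.
Qed.

(** Repetitions in [s] encode powers, so that multiplying monomials is concatenating lists. *)
Definition monomial (s : seq nat) (w : T) : R := \prod_(k <- s) Z k w.

Lemma monomialE (s : seq nat) (r : seq nat) (w : T) : uniq r -> {subset s <= r} ->
  monomial s w = \prod_(k <- r) Z k w ^+ count_mem k s.
Proof.
move=> ur; rewrite /monomial; elim: s => [|k s IH] sr.
  by rewrite big_nil big1// => k _; rewrite /= expr0.
rewrite big_cons IH; last by move=> j js; apply: sr; rewrite inE js orbT.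
have kr : k \in r by apply: sr; rewrite mem_head.
rewrite !(bigD1_seq k kr ur) /= eqxx exprS mulrA; congr (_ * _).
by apply: eq_bigr => j jk; rewrite eq_sym (negbTE jk).
Qed.

Lemma integrable_monomial (s : seq nat) :
  P.-integrable setT (EFin \o monomial s).
Proof.
have mf k : measurable_fun setT (fun x : R => x ^+ count_mem k s).
  exact: measurable_funX.
have := @integrable_prod (fun k x => x ^+ count_mem k s) mf
  (fun k => integrable_exprn_std_normal _) (undup s) (undup_uniq s).
congr (integrable _ _ _); apply/funext => w /=.
by rewrite (@monomialE s (undup s))// ?undup_uniq// => j; rewrite mem_undup.
Qed.

Lemma Rintegral_monomial (s r : seq nat) : uniq r -> {subset s <= r} ->
  Rintegral P setT (monomial s) = \prod_(k <- r) EN (fun x => x ^+ count_mem k s).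
Proof.
move=> ur sr; rewrite -Rintegral_prod//.
- by apply: eq_Rintegral => w _; exact: monomialE.
- by move=> k; exact: integrable_exprn_std_normal.
Qed.

(** All three moments are written as products over the common index list [undup (s ++ t)]; at each
    index one of the two exponents is 0, and that factor is E 1 = 1. *)
Lemma Rintegral_monomial_cat (s t : seq nat) :
  (forall k, k \in s -> k \notin t) ->
  Rintegral P setT (monomial (s ++ t)) =
  Rintegral P setT (monomial s) * Rintegral P setT (monomial t).
Proof.
move=> st.
rewrite (@Rintegral_monomial _ (undup (s ++ t)) (undup_uniq _)); last first.
  by move=> j; rewrite mem_undup.
rewrite (@Rintegral_monomial s (undup (s ++ t)) (undup_uniq _)); last first.
  by move=> j js; rewrite mem_undup mem_cat js.
rewrite (@Rintegral_monomial t (undup (s ++ t)) (undup_uniq _)); last first.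
  by move=> j js; rewrite mem_undup mem_cat js orbT.
rewrite -big_split /=; apply: eq_bigr => k _; rewrite count_cat.
have one : EN (fun x => x ^+ 0) = 1 by exact: Rintegral_cst_std_normal.
have [ks|ks] := boolP (k \in s).
  by rewrite (count_memPn (st _ ks)) addn0 one mulr1.
by rewrite (count_memPn ks) add0n one mul1r.
Qed.

End independent_normals.

(** * Polynomials in complex Gaussian variables *)

Section complex_expectation.
Local Open Scope complex_scope.
Context {R : realType} {d : measure_display} {T : measurableType d}.
Variable P : probability T R.
Local Notation C := R[i].

Definition cintegrable (X : T -> C) : Prop :=
  P.-integrable setT (EFin \o (fun w => complex.Re (X w))) /\
  P.-integrable setT (EFin \o (fun w => complex.Im (X w))).

Lemma eq_cE (X Y : T -> C) : X =1 Y -> cE P X = cE P Y.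
Proof. by move=> /funext ->. Qed.

Lemma cE_cst (c : C) : cE P (fun=> c) = c.
Proof.
rewrite /cE !Rintegral_cst//.
have -> : fine (P setT) = 1 by rewrite probability_setT.
by rewrite !mulr1; case: c.
Qed.

Lemma cintegrable_cst (c : C) : cintegrable (fun=> c).
Proof.
split; exact: (@finite_measure_integrable_cst _ _ _ P _ _ measurableT).
Qed.

Lemma cintegrableD (X Y : T -> C) : cintegrable X -> cintegrable Y ->
  cintegrable (fun w => X w + Y w).
Proof.
move=> [X1 X2] [Y1 Y2]; split.
  have := integrableD measurableT X1 Y1; congr (integrable _ _ _).
  by apply/funext => w /=; case: (X w); case: (Y w).
have := integrableD measurableT X2 Y2; congr (integrable _ _ _).
by apply/funext => w /=; case: (X w); case: (Y w).
Qed.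

Lemma cED (X Y : T -> C) : cintegrable X -> cintegrable Y ->
  cE P (fun w => X w + Y w) = cE P X + cE P Y.
Proof.
move=> [X1 X2] [Y1 Y2]; rewrite /cE.
rewrite [RHS](_ : _ = (Rintegral P setT (fun w => complex.Re (X w)) +
  Rintegral P setT (fun w => complex.Re (Y w))) +i*
  (Rintegral P setT (fun w => complex.Im (X w)) +
  Rintegral P setT (fun w => complex.Im (Y w))))//.
rewrite -!RintegralD//; congr (_ +i* _); apply: eq_Rintegral => w _.
  by case: (X w); case: (Y w).
by case: (X w); case: (Y w).
Qed.

Lemma cintegrableZ (c : C) (X : T -> C) : cintegrable X ->
  cintegrable (fun w => c * X w).
Proof.
case: c => a b [X1 X2]; split.
  have := integrableB measurableT (integrableZl measurableT a X1)
    (integrableZl measurableT b X2).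
  by congr (integrable _ _ _); apply/funext => w /=; case: (X w).
have := integrableD measurableT (integrableZl measurableT a X2)
  (integrableZl measurableT b X1).
by congr (integrable _ _ _); apply/funext => w /=; case: (X w).
Qed.

Lemma cEZ (c : C) (X : T -> C) : cintegrable X ->
  cE P (fun w => c * X w) = c * cE P X.
Proof.
case: c => a b [X1 X2]; rewrite /cE.
have X1z r := integrableZl measurableT r X1.
have X2z r := integrableZl measurableT r X2.
rewrite [RHS](_ : _ =
  (a * Rintegral P setT (fun w => complex.Re (X w)) -
   b * Rintegral P setT (fun w => complex.Im (X w))) +i*
  (a * Rintegral P setT (fun w => complex.Im (X w)) +
   b * Rintegral P setT (fun w => complex.Re (X w))))//.
congr (_ +i* _).
  rewrite -!RintegralZl// -RintegralB//; [|exact: X1z|exact: X2z].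
  by apply: eq_Rintegral => w _; case: (X w).
rewrite -!RintegralZl// -RintegralD//; [|exact: X2z|exact: X1z].
by apply: eq_Rintegral => w _; case: (X w).
Qed.

Lemma cE_conj (X : T -> C) : cintegrable X ->
  cE P (fun w => conjc (X w)) = conjc (cE P X).
Proof.
move=> [X1 X2]; rewrite /cE /=; congr (_ +i* _).
  by apply: eq_Rintegral => w _; case: (X w).
rewrite -mulN1r -RintegralZl//; apply: eq_Rintegral => w _.
by rewrite mulN1r; case: (X w).
Qed.

Lemma cintegrable_sum (I : Type) (r : seq I) (X : I -> T -> C) :
  (forall i, cintegrable (X i)) -> cintegrable (fun w => \sum_(i <- r) X i w).
Proof.
move=> iX; elim: r => [|i r IH].
  rewrite (_ : (fun w => _) = fun=> 0); first exact: cintegrable_cst.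
  by apply/funext => w; rewrite big_nil.
rewrite (_ : (fun w => _) = fun w => X i w + \sum_(i <- r) X i w).
  exact: cintegrableD.
by apply/funext => w; rewrite big_cons.
Qed.

Lemma cE_sum (I : Type) (r : seq I) (X : I -> T -> C) :
  (forall i, cintegrable (X i)) ->
  cE P (fun w => \sum_(i <- r) X i w) = \sum_(i <- r) cE P (X i).
Proof.
move=> iX; elim: r => [|i r IH].
  rewrite big_nil -[RHS]cE_cst; apply: eq_cE => w; by rewrite big_nil.
rewrite big_cons -IH -cED//; last exact: cintegrable_sum.
by apply: eq_cE => w; rewrite big_cons.
Qed.

Lemma cE_ge0 (X : T -> C) : (forall w, 0 <= X w) -> 0 <= cE P X.
Proof.
move=> X0; rewrite /cE lecE /=.
have h w : complex.Im (X w) = 0 /\ 0 <= complex.Re (X w).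
  by have := X0 w; rewrite lecE => /andP[/eqP ? ?].
rewrite Rintegral_ge0 ?andbT; last by move=> w _; have [] := h w.
rewrite (@eq_Rintegral _ _ _ _ _ (fun=> 0)) ?Rintegral_cst ?mul0r//.
by move=> w _; have [] := h w.
Qed.

End complex_expectation.

(** Dropping the last entry of the code forgets the real/imaginary bit, so both halves of a complex
    Gaussian have the same label. *)
Definition label (k : nat) : seq nat :=
  let c := CodeSeq.decode k in take (size c).-1 c.

Lemma label_code (c : seq nat) (b : nat) : label (CodeSeq.code (rcons c b)) = c.
Proof. by rewrite /label CodeSeq.codeK size_rcons /= -cats1 take_size_cat. Qed.

Section gaussian_polynomials.
Local Open Scope complex_scope.
Context {R : realType} {d : measure_display} {T : measurableType d}.
Variables (P : probability T R) (Z : nat -> T -> R).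
Hypothesis normalZ : forall k, std_normal_rv P (Z k).
Hypothesis indepZ : mutually_independent P Z.
Local Notation C := R[i].
Local Notation cE := (cE P).
Local Notation cintegrable := (cintegrable P).
Local Notation N := (normal_prob (0 : R) 1).

(** [L] bounds the labels that may occur. Disjoint bounds are the usable form of independence, and
    they are preserved by the algebraic operations and conjugation. *)
Definition cpoly (L : pred (seq nat)) (X : T -> C) : Prop :=
  exists2 l : seq (C * seq nat),
    forall x, x \in l -> forall k, k \in x.2 -> L (label k) &
    forall w, X w = \sum_(x <- l) x.1 * (monomial Z x.2 w)%:C.

Lemma cpolyW (L L' : pred (seq nat)) (X : T -> C) :
  (forall c, L c -> L' c) -> cpoly L X -> cpoly L' X.
Proof.
by move=> LL' [l lL XE]; exists l => // x xl k kx; exact/LL'/(lL x).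
Qed.

Lemma eq_cpoly L (X Y : T -> C) : X =1 Y -> cpoly L X -> cpoly L Y.
Proof. by move=> /funext ->. Qed.

Lemma cpoly_cst L c : cpoly L (fun=> c).
Proof.
exists [:: (c, [::])]; first by move=> x; rewrite inE => /eqP ->.
by move=> w; rewrite big_seq1 /monomial big_nil mulr1.
Qed.

Lemma cpolyD L (X Y : T -> C) : cpoly L X -> cpoly L Y ->
  cpoly L (fun w => X w + Y w).
Proof.
move=> [l lL XE] [m mL YE]; exists (l ++ m).
  by move=> x; rewrite mem_cat => /orP[/lL|/mL].
by move=> w; rewrite big_cat /= XE YE.
Qed.

Lemma monomial_cat s t w : monomial Z (s ++ t) w = monomial Z s w * monomial Z t w.
Proof. by rewrite /monomial big_cat. Qed.

Lemma cpolyM L (X Y : T -> C) : cpoly L X -> cpoly L Y ->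
  cpoly L (fun w => X w * Y w).
Proof.
move=> [l lL XE] [m mL YE].
exists [seq (x.1 * y.1, x.2 ++ y.2) | x <- l, y <- m].
  move=> _ /allpairsP[[x y] /= [xl ym ->]] k /=; rewrite mem_cat => /orP[|].
    exact: lL.
  exact: mL.
move=> w; rewrite big_allpairs_dep /= XE YE mulr_suml; apply: eq_bigr => x _.
rewrite mulr_sumr; apply: eq_bigr => y _.
by rewrite monomial_cat rmorphM /= mulrACA.
Qed.

Lemma cpoly_conj L (X : T -> C) : cpoly L X -> cpoly L (fun w => conjc (X w)).
Proof.
move=> [l lL XE]; exists [seq (conjc x.1, x.2) | x <- l].
  by move=> _ /mapP[x xl ->] k /=; exact: lL.
move=> w; rewrite XE rmorph_sum big_map; apply: eq_bigr => x _.
by rewrite rmorphM /= oppr0.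
Qed.

Lemma cpoly_sum L (I : Type) (r : seq I) (X : I -> T -> C) :
  (forall i, cpoly L (X i)) -> cpoly L (fun w => \sum_(i <- r) X i w).
Proof.
move=> iX; elim: r => [|i r IH].
  by apply: (@eq_cpoly L (fun=> 0)); [move=> w; rewrite big_nil|exact: cpoly_cst].
apply: (@eq_cpoly L (fun w => X i w + \sum_(i <- r) X i w)); last exact: cpolyD.
by move=> w; rewrite big_cons.
Qed.

Lemma cpolyB L (X Y : T -> C) : cpoly L X -> cpoly L Y ->
  cpoly L (fun w => X w - Y w).
Proof.
move=> pX pY; apply: (@eq_cpoly L (fun w => X w + (-1) * Y w)).
  by move=> w; rewrite mulN1r.
by apply: cpolyD => //; apply: cpolyM => //; exact: cpoly_cst.
Qed.

Lemma cgaussE c w : cgauss Z c w =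
  ((Num.sqrt 2)^-1)%:C * (monomial Z [:: CodeSeq.code (rcons c 0)] w)%:C +
  (0 +i* (Num.sqrt 2)^-1) * (monomial Z [:: CodeSeq.code (rcons c 1)] w)%:C.
Proof.
rewrite /cgauss /monomial !big_seq1; apply/eqP; rewrite eq_complex /=.
by rewrite !mulr0 !mul0r !subr0 !addr0 !add0r !(mulrC (Num.sqrt 2)^-1) !eqxx.
Qed.

Lemma cpoly_cgauss (L : pred (seq nat)) c : L c -> cpoly L (cgauss Z c).
Proof.
move=> Lc; exists [:: (((Num.sqrt 2)^-1)%:C, [:: CodeSeq.code (rcons c 0)]);
    (0 +i* (Num.sqrt 2)^-1, [:: CodeSeq.code (rcons c 1)])].
  by move=> x; rewrite !inE => /orP[] /eqP -> k /=; rewrite inE => /eqP ->;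
    rewrite label_code.
by move=> w; rewrite !big_cons big_nil addr0 cgaussE.
Qed.

Lemma cintegrable_monomial s : cintegrable (fun w => (monomial Z s w)%:C).
Proof.
split; first exact: (integrable_monomial _ _ normalZ indepZ).
exact: (@finite_measure_integrable_cst _ _ _ P _ 0 measurableT).
Qed.

Lemma cE_monomial s :
  cE (fun w => (monomial Z s w)%:C) = (Rintegral P setT (monomial Z s))%:C.
Proof. by rewrite /Defs.cE /= Rintegral_cst// mul0r. Qed.

Lemma cpoly_integrable L X : cpoly L X -> cintegrable X.
Proof.
move=> [l _ /funext ->]; apply: cintegrable_sum => x.
exact/cintegrableZ/cintegrable_monomial.
Qed.

Lemma cE_polynomial (l : seq (C * seq nat)) :
  cE (fun w => \sum_(x <- l) x.1 * (monomial Z x.2 w)%:C) =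
  \sum_(x <- l) x.1 * (Rintegral P setT (monomial Z x.2))%:C.
Proof.
rewrite (@cE_sum _ _ _ _ _ _ (fun x w => x.1 * (monomial Z x.2 w)%:C)); last first.
  by move=> x; exact/cintegrableZ/cintegrable_monomial.
apply: eq_bigr => x _; rewrite cEZ ?cE_monomial//.
exact: cintegrable_monomial.
Qed.

(** After expanding both factors, disjoint label sets mean that no index is shared by a monomial of
    [X] and one of [Y], so each product of monomials factors. *)
Lemma cEM (L L' : pred (seq nat)) X Y : (forall c, L c -> ~~ L' c) ->
  cpoly L X -> cpoly L' Y -> cE (fun w => X w * Y w) = cE X * cE Y.
Proof.
move=> LL' [l lL /funext ->] [m mL /funext ->].
rewrite !cE_polynomial mulr_suml.
pose lm := [seq (x.1 * y.1, x.2 ++ y.2) | x <- l, y <- m].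
rewrite (@eq_cE _ _ _ _ _ (fun w => \sum_(x <- lm) x.1 * (monomial Z x.2 w)%:C)); last first.
  move=> w; rewrite big_allpairs_dep /= mulr_suml; apply: eq_bigr => x _.
  rewrite mulr_sumr; apply: eq_bigr => y _.
  by rewrite monomial_cat rmorphM /= mulrACA.
rewrite cE_polynomial big_allpairs_dep /= !big_seq; apply: eq_bigr => x xl.
rewrite mulr_sumr !big_seq; apply: eq_bigr => y ym.
rewrite (Rintegral_monomial_cat _ _ normalZ indepZ).
  by rewrite rmorphM /= mulrACA.
move=> k kx; apply/negP => ky.
by have := LL' _ (lL x xl k kx); rewrite (mL y ym k ky).
Qed.

(** This is E |z|^2 for every [z] of the form [cgauss Z c]: the real and imaginary halves contribute
    half of it each. *)
Definition gvar : C := (Rintegral N setT (fun x => x ^+ 2))%:C.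

Lemma gvar_gt0 : 0 < gvar.
Proof. by rewrite /gvar ltcR std_normal_var_gt0. Qed.

Lemma Rintegral_monomial1 k : Rintegral P setT (monomial Z [:: k]) = 0.
Proof.
rewrite (@Rintegral_monomial _ _ _ _ _ normalZ indepZ _ [:: k])//.
rewrite big_seq1 /= eqxx -[RHS]std_normal_mean.
by apply: eq_Rintegral => x _; rewrite expr1.
Qed.

Lemma Rintegral_monomial2 k : (Rintegral P setT (monomial Z [:: k; k]))%:C = gvar.
Proof.
rewrite (@Rintegral_monomial _ _ _ _ _ normalZ indepZ _ [:: k])//.
  by rewrite big_seq1 /= eqxx.
by move=> j; rewrite !inE orbb.
Qed.

Lemma cE_cgauss c : cE (cgauss Z c) = 0.
Proof.
rewrite (@eq_cE _ _ _ _ _ (fun w => \sum_(x <- [::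
    (((Num.sqrt 2)^-1)%:C, [:: CodeSeq.code (rcons c 0)]);
    (0 +i* (Num.sqrt 2)^-1, [:: CodeSeq.code (rcons c 1)])])
  x.1 * (monomial Z x.2 w)%:C)); last first.
  by move=> w; rewrite !big_cons big_nil addr0 cgaussE.
rewrite cE_polynomial !big_cons big_nil /= !Rintegral_monomial1.
by rewrite !mulr0 !addr0.
Qed.

Lemma cE_cgauss_sqr c :
  cE (fun w => cgauss Z c w * conjc (cgauss Z c w)) = gvar.
Proof.
pose k0 := CodeSeq.code (rcons c 0); pose k1 := CodeSeq.code (rcons c 1).
rewrite (@eq_cE _ _ _ _ _ (fun w => \sum_(x <- [::
    ((2^-1)%:C, [:: k0; k0]); ((2^-1)%:C, [:: k1; k1])])
  x.1 * (monomial Z x.2 w)%:C)); last first.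
  move=> w; rewrite !big_cons big_nil addr0 /cgauss /monomial !big_cons !big_nil.
  have h2 : 2^-1 = (Num.sqrt 2)^-1 * (Num.sqrt 2)^-1 :> R.
    by rewrite -invfM -expr2 sqr_sqrtr.
  have h0 : Num.sqrt 2 != 0 :> R by rewrite gt_eqF// sqrtr_gt0.
  rewrite -/k0 -/k1 !mulr1; apply/eqP; rewrite eq_complex /= h2.
  by apply/andP; split; apply/eqP; field.
rewrite cE_polynomial !big_cons big_nil addr0 /= !Rintegral_monomial2.
rewrite -mulrDl -rmorphD /=.
by rewrite -(_ : 1 = 2^-1 + 2^-1 :> R) ?mul1r//; field.
Qed.

(* Conditionally on everything else, each fresh Gaussian factor is centred, so
   all cross terms vanish. *)
Lemma cE_sqr_gauss_sum (I : eqType) (L : pred (seq nat)) (r : seq I)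
    (lab : I -> seq nat) (F : I -> T -> C) (Y : T -> C) :
  uniq [seq lab i | i <- r] -> (forall i, i \in r -> ~~ L (lab i)) ->
  cpoly L Y -> (forall i, cpoly L (F i)) ->
  let S w := Y w + \sum_(i <- r) F i w * cgauss Z (lab i) w in
  cE (fun w => S w * conjc (S w)) =
  cE (fun w => Y w * conjc (Y w)) +
  gvar * \sum_(i <- r) cE (fun w => F i w * conjc (F i w)).
Proof.
move=> ur Lr pY pF /=.
elim: r ur Lr => [|i r IH] /= ur Lr.
  rewrite big_nil mulr0 addr0; apply: eq_cE => w.
  by rewrite big_nil addr0.
have /andP[ir {}ur] := ur.
have {}IH := IH ur (fun j jr => Lr j (mem_behead (s := i :: r) jr)).
(* Everything already summed has labels in [L'], and [lab i] lies outside it by uniqueness: this is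
   the freshness of the new term. *)
pose L' : pred (seq nat) := fun c => L c || (c \in [seq lab i | i <- r]).
pose S w := Y w + \sum_(j <- r) F j w * cgauss Z (lab j) w.
pose G := cgauss Z (lab i).
have LL' c : L c -> L' c by rewrite /L' => ->.
have pS : cpoly L' S.
  apply: cpolyD; first exact: cpolyW LL' _.
  (* [cpoly_sum] asks for a polynomial at every index of the type, while [lab j] is in [L'] only for
     [j] in [r]; the other terms are replaced by 0. *)
  apply: (@eq_cpoly _ (fun w => \sum_(j <- r | j \in r) F j w * cgauss Z (lab j) w)).
    by move=> w; rewrite -big_seq.
  apply: (@eq_cpoly _ (fun w => \sum_(j <- r)
     (if j \in r then F j w * cgauss Z (lab j) w else 0))).
    by move=> w; rewrite -big_mkcond.
  apply: cpoly_sum => j; case jr : (j \in r); last exact: cpoly_cst.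
  apply: cpolyM; first exact: cpolyW LL' (pF j).
  by apply: cpoly_cgauss; rewrite /L' map_f ?orbT.
have pG : cpoly (pred1 (lab i)) G by apply: cpoly_cgauss; rewrite /= eqxx.
have pF' : cpoly L' (F i) by exact: cpolyW LL' (pF i).
have dis c : L' c -> ~~ pred1 (lab i) c.
  move=> L'c; apply/negP => /= /eqP ci; move: L'c; rewrite /L' ci.
  by rewrite (negbTE ir) orbF (negbTE (Lr i _))// mem_head.
have A1 : cpoly L' (fun w => S w * conjc (F i w)).
  by apply: cpolyM => //; exact: cpoly_conj.
have A2 : cpoly L' (fun w => conjc (S w) * F i w).
  by apply: cpolyM => //; exact: cpoly_conj.
have A3 : cpoly L' (fun w => F i w * conjc (F i w)).
  by apply: cpolyM => //; exact: cpoly_conj.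
have A4 : cpoly (pred1 (lab i)) (fun w => G w * conjc (G w)).
  by apply: cpolyM => //; exact: cpoly_conj.
have A5 : cpoly L' (fun w => S w * conjc (S w)).
  by apply: cpolyM => //; exact: cpoly_conj.
have all L0 X : cpoly L0 X -> cpoly predT X by exact: cpolyW.
have int X : cpoly predT X -> cintegrable X by exact: cpoly_integrable.
have B1 : cpoly predT (fun w => (S w * conjc (F i w)) * conjc (G w)).
  by apply: cpolyM; [exact: all A1|apply: cpoly_conj; exact: all pG].
have B2 : cpoly predT (fun w => (conjc (S w) * F i w) * G w).
  by apply: cpolyM; [exact: all A2|exact: all pG].
have B3 : cpoly predT (fun w => (F i w * conjc (F i w)) * (G w * conjc (G w))).
  by apply: cpolyM; [exact: all A3|exact: all A4].
rewrite (@eq_cE _ _ _ _ _ (fun w =>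
  S w * conjc (S w) + ((S w * conjc (F i w)) * conjc (G w) +
  ((conjc (S w) * F i w) * G w +
    (F i w * conjc (F i w)) * (G w * conjc (G w)))))); last first.
  move=> w; rewrite big_cons addrCA -/(S w) -/(G w) rmorphD rmorphM /=; ring.
rewrite cED; first last.
- by apply: int; apply: cpolyD => //; exact: cpolyD.
- by apply: int; exact: all A5.
rewrite cED; first last.
- by apply: int; exact: cpolyD.
- exact: int.
rewrite cED; try exact: int.
rewrite (cEM _ _ _ _ dis A1 (cpoly_conj _ _ pG)) (cEM _ _ _ _ dis A2 pG).
rewrite (cEM _ _ _ _ dis A3 A4).
rewrite cE_conj; last by apply: int; exact: all pG.
rewrite cE_cgauss conjc0 !mulr0 !add0r cE_cgauss_sqr IH big_cons.
by rewrite mulrDr [gvar * cE _]mulrC -addrA [X in _ + X]addrC.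
Qed.

End gaussian_polynomials.

(** * Hermitian forms *)

Set Implicit Arguments.
Unset Strict Implicit.
Unset Printing Implicit Defensive.

Section hermitian_forms.
Local Open Scope complex_scope.
Context {R : realType}.
Local Notation C := R[i].

Lemma hTD m n (A B : 'M[C]_(m, n)) : hT (A + B) = hT A + hT B.
Proof. by rewrite /hT map_mxD linearD. Qed.

Lemma hTB m n (A B : 'M[C]_(m, n)) : hT (A - B) = hT A - hT B.
Proof. by rewrite /hT map_mxB linearB. Qed.

Lemma hTZ m n (c : C) (A : 'M[C]_(m, n)) : hT (c *: A) = conjc c *: hT A.
Proof. by rewrite /hT map_mxZ linearZ. Qed.

Lemma hTM m n k (A : 'M[C]_(m, n)) (B : 'M[C]_(n, k)) :
  hT (A *m B) = hT B *m hT A.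
Proof. by rewrite /hT map_mxM trmx_mul. Qed.

Lemma hTK m n (A : 'M[C]_(m, n)) : hT (hT A) = A.
Proof. by apply/matrixP => i j; rewrite !mxE conjcK. Qed.

Lemma hT_scalar n (x : R) : hT (x%:C%:M : 'M[C]_n) = x%:C%:M.
Proof.
apply/matrixP => i j; rewrite !mxE rmorphMn /= oppr0 [j == i]eq_sym //.
Qed.

Lemma hT_invmx n (A : 'M[C]_n) : hT (invmx A) = invmx (hT A).
Proof. by rewrite /hT map_invmx trmx_inv. Qed.

Definition hform n (S : 'M[C]_n) (u v : 'cV[C]_n) : C :=
  (hT u *m S *m v) 0 0.

Definition sqnorm n (v : 'cV[C]_n) : C := (hT v *m v) 0 0.

Definition psd n (S : 'M[C]_n) : Prop :=
  hT S = S /\ forall v, 0 <= hform S v v.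

Lemma sqnormE n (v : 'cV[C]_n) : sqnorm v = \sum_i v i 0 * conjc (v i 0).
Proof.
by rewrite /sqnorm !mxE; apply: eq_bigr => i _; rewrite !mxE mulrC.
Qed.

Lemma sqnorm_ge0 n (v : 'cV[C]_n) : 0 <= sqnorm v.
Proof. by rewrite sqnormE sumr_ge0// => i _; exact: mulcJ_ge0. Qed.

Lemma sqnorm_gt0 n (v : 'cV[C]_n) : v != 0 -> 0 < sqnorm v.
Proof.
move=> v0; rewrite lt_def sqnorm_ge0 andbT; apply: contraNneq v0.
rewrite sqnormE => /eqP; rewrite psumr_eq0; last by move=> i _; exact: mulcJ_ge0.
move=> /allP h; apply/eqP/matrixP => i j; rewrite ord1 mxE.
have := h i (mem_index_enum i); rewrite /= mulf_eq0 conjc_eq0 orbb.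
by move/eqP.
Qed.

Lemma hformE n (S : 'M[C]_n) u v : hform S u v = (hT u *m (S *m v)) 0 0.
Proof. by rewrite /hform mulmxA. Qed.

Lemma hform_conj n (S : 'M[C]_n) u v : hT S = S ->
  hform S v u = conjc (hform S u v).
Proof.
move=> hS; rewrite /hform.
have -> : hT v *m S *m u = hT (hT u *m S *m v).
  by rewrite !hTM hTK hS mulmxA.
by rewrite !mxE.
Qed.

Lemma hformB n (S : 'M[C]_n) u v t : hT S = S ->
  hform S (v - t *: u) (v - t *: u) =
  hform S v v - t * hform S v u - conjc t * hform S u v +
  t * conjc t * hform S u u.
Proof.
move=> hS; rewrite /hform hTB hTZ !mulmxBl !mulmxBr -!scalemxAl -!scalemxAr.
by rewrite !mxE; ring.
Qed.

Lemma hformD n (S S' : 'M[C]_n) u v : hform (S + S') u v = hform S u v + hform S' u v.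
Proof. by rewrite /hform mulmxDr mulmxDl mxE. Qed.

Lemma hformZ n (c : C) (S : 'M[C]_n) u v : hform (c *: S) u v = c * hform S u v.
Proof. by rewrite /hform -scalemxAr -scalemxAl mxE. Qed.

Lemma hform_scalar n (c : C) (v : 'cV[C]_n) : hform c%:M v v = c * sqnorm v.
Proof. by rewrite /hform mul_mx_scalar -scalemxAl mxE. Qed.

Lemma psd_diag_ge0 n (S : 'M[C]_n) i : psd S -> 0 <= S i i.
Proof.
move=> [_ /(_ (delta_mx i 0))]; rewrite hformE -colE mxE (bigD1 i)//= big1.
  by rewrite !mxE !eqxx /= oppr0 mul1r addr0.
by move=> j ji; rewrite !mxE (negbTE ji) /= oppr0 mul0r.
Qed.

Lemma posdef_unitmx n (S : 'M[C]_n) :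
  (forall v, v != 0 -> 0 < hform S v v) -> S \in unitmx.
Proof.
move=> pS; rewrite unitmxE unitfE; apply/negP => /det0P[v v0 vS].
have := pS (hT v); rewrite /hform hTK vS mul0mx mxE ltxx.
suff -> : hT v != 0 by move=> /(_ isT).
apply: contraNneq v0 => hv; rewrite -(hTK v) hv.
by apply/eqP/matrixP => i j; rewrite !mxE conjc0.
Qed.

Section coercive.
Variables (n : nat) (S : 'M[C]_n) (D : C).
Hypotheses (hS : hT S = S) (D0 : 0 < D)
  (coe : forall v, D * sqnorm v <= hform S v v).

Lemma coercive_unitmx : S \in unitmx.
Proof.
apply: posdef_unitmx => v v0; apply: (lt_le_trans _ (coe v)).
by rewrite mulr_gt0// sqnorm_gt0.
Qed.

Let uS := coercive_unitmx.

(** With u = S^-1 v, the form of S^-1 at v is the form of S at u. *)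
Lemma coercive_inv_psd : psd (invmx S).
Proof.
have hI : hT (invmx S) = invmx S by rewrite hT_invmx hS.
split=> // v.
have -> : hform (invmx S) v v = hform S (invmx S *m v) (invmx S *m v).
  by rewrite hformE (hformE S) mulKVmx// hTM hI -mulmxA.
by apply: (le_trans _ (coe _)); rewrite mulr_ge0 ?sqnorm_ge0 ?(ltW D0).
Qed.

(* [0 <= |v - D u|^2 = |v|^2 - 2 D q + D^2 |u|^2 <= |v|^2 - D q] with
   [u = S^-1 v] and [q = v^H S^-1 v]. *)
Lemma coercive_inv_le (v : 'cV[C]_n) : hform (invmx S) v v <= sqnorm v / D.
Proof.
have [hI _] := coercive_inv_psd.
set u := invmx S *m v; set q := hform _ _ _.
have qE : q = hform S u u.
  by rewrite /q hformE (hformE S) mulKVmx// hTM hI -mulmxA.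
have vu : (hT v *m u) 0 0 = q by rewrite /q hformE.
have uv : (hT u *m v) 0 0 = q by rewrite qE hformE mulKVmx.
have Dr : conjc D = D.
  have : 0 <= D by exact: ltW.
  by rewrite lecE /= => /andP[/eqP]; case: (D) => a b /= -> _; rewrite oppr0.
have := sqnorm_ge0 (v - D *: u).
have -> : sqnorm (v - D *: u) = sqnorm v - 2 * D * q + D * (D * sqnorm u).
  rewrite /sqnorm hTB hTZ Dr !mulmxBl !mulmxBr -!scalemxAl -!scalemxAr.
  have e1 (A B : 'M[C]_1) : (A - B) 0 0 = A 0 0 - B 0 0 by rewrite !mxE.
  have e2 c (A : 'M[C]_1) : (c *: A) 0 0 = c * A 0 0 by rewrite !mxE.
  by rewrite !(e1, e2) vu uv; ring.
have cu : D * sqnorm u <= q by rewrite qE.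
rewrite ler_pdivlMr// => h.
rewrite -subr_ge0; apply: (le_trans h).
have : D * (D * sqnorm u) <= D * q by rewrite ler_pM2l.
rewrite -subr_ge0 => h2; rewrite -subr_ge0; apply: (le_trans h2).
by rewrite le_eqVlt; apply/orP; left; apply/eqP; ring.
Qed.

End coercive.

(** For c > 0 the middle expression is the minimum over t of S(v - t u, v - t u) + |t|^2 / c, a
    regularised projection of [v] on [u]: it is a sum of nonnegative terms, and t = 0 gives the
    upper bound. The proof uses the closed forms, which also cover c = 0. *)
Lemma schur_complement_bounds n (S : 'M[C]_n) (c : C) (u v : 'cV[C]_n) :
  psd S -> 0 <= c ->
  0 <= hform S v v -
    c * hform S v u * hform S u v / (1 + c * hform S u u) <= hform S v v.
Proof.
move=> [hS pS] c0.
set a := hform S v v; set b := hform S u u.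
have b0 : 0 <= b by exact: pS.
have cb : 0 < 1 + c * b by rewrite ltr_wpDr ?mulr_ge0.
have s0 : 0 <= hform S v u * hform S u v.
  by rewrite (hform_conj u v hS) mulrC mulcJ_ge0.
have real x : 0 <= x -> conjc x = x :> C.
  by rewrite lecE /= => /andP[/eqP]; case: x => x1 x2 /= -> _; rewrite oppr0.
apply/andP; split; last first.
  by rewrite gerBl -(mulrA c (hform S v u)) divr_ge0 ?(ltW cb)// mulr_ge0.
(* The minimiser; the penalty |t|^2 / c becomes the last term of the identity below. *)
pose t := c * hform S u v / (1 + c * b).
have tc : conjc t = c * hform S v u / (1 + c * b).
  rewrite /t !rmorphM /= fmorphV /= (real _ c0) (real _ (ltW cb)).
  by rewrite -(hform_conj _ _ hS).
have -> : a - c * hform S v u * hform S u v / (1 + c * b) =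
    hform S (v - t *: u) (v - t *: u) +
    c * (hform S v u * hform S u v) / (1 + c * b) ^+ 2.
  rewrite hformB// tc -/a -/b /t; field.
  by rewrite gt_eqF.
by rewrite addr_ge0// divr_ge0 ?exprn_ge0 ?(ltW cb)// mulr_ge0.
Qed.

End hermitian_forms.

(** * Matrix expectations and LMMSE estimation *)

Section matrix_expectation.
Local Open Scope complex_scope.
Context {R : realType} {d : measure_display} {T : measurableType d}.
Variables (P : probability T R) (Z : nat -> T -> R).
Hypothesis normalZ : forall k, std_normal_rv P (Z k).
Hypothesis indepZ : mutually_independent P Z.
Local Notation C := R[i].
Local Notation cE := (cE P).
Local Notation cpoly := (cpoly Z).

Let int L X : cpoly L X -> cintegrable P X.
Proof. exact: cpoly_integrable. Qed.

Definition mpoly (L : pred (seq nat)) m n (F : T -> 'M[C]_(m, n)) : Prop :=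
  forall a b, cpoly L (fun w => F w a b).

Definition mE m n (F : T -> 'M[C]_(m, n)) : 'M[C]_(m, n) :=
  \matrix_(a, b) cE (fun w => F w a b).

Section closure.
Variable L : pred (seq nat).

Lemma mpoly_cst m n (A : 'M[C]_(m, n)) : mpoly L (fun=> A).
Proof. by move=> a b; exact: cpoly_cst. Qed.

Lemma mpolyD m n (F G : T -> 'M[C]_(m, n)) : mpoly L F -> mpoly L G ->
  mpoly L (fun w => F w + G w).
Proof.
move=> pF pG a b; apply: (eq_cpoly _ _ _ _ _ (cpolyD _ _ _ _ (pF a b) (pG a b))).
by move=> w; rewrite mxE.
Qed.

Lemma mpolyB m n (F G : T -> 'M[C]_(m, n)) : mpoly L F -> mpoly L G ->
  mpoly L (fun w => F w - G w).
Proof.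
move=> pF pG a b; apply: (eq_cpoly _ _ _ _ _ (cpolyB _ _ _ _ (pF a b) (pG a b))).
by move=> w; rewrite !mxE.
Qed.

Lemma mpolyZ m n (c : T -> C) (F : T -> 'M[C]_(m, n)) :
  cpoly L c -> mpoly L F -> mpoly L (fun w => c w *: F w).
Proof.
move=> pc pF a b; apply: (eq_cpoly _ _ _ _ _ (cpolyM _ _ _ _ pc (pF a b))).
by move=> w; rewrite mxE.
Qed.

Lemma mpoly_hT m n (F : T -> 'M[C]_(m, n)) :
  mpoly L F -> mpoly L (fun w => hT (F w)).
Proof.
move=> pF a b; apply: (eq_cpoly _ _ _ _ _ (cpoly_conj _ _ _ (pF b a))).
by move=> w; rewrite !mxE.
Qed.

Lemma mpolyM m n k (F : T -> 'M[C]_(m, n)) (G : T -> 'M[C]_(n, k)) :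
  mpoly L F -> mpoly L G -> mpoly L (fun w => F w *m G w).
Proof.
move=> pF pG a b.
apply: (@eq_cpoly _ _ _ _ L (fun w => \sum_j F w a j * G w j b)).
  by move=> w; rewrite mxE.
by apply: cpoly_sum => j; exact: cpolyM.
Qed.

End closure.

Variable L : pred (seq nat).

Lemma mE_cst m n (A : 'M[C]_(m, n)) : mE (fun=> A) = A.
Proof. by apply/matrixP => a b; rewrite mxE cE_cst. Qed.

Lemma mED m n (F G : T -> 'M[C]_(m, n)) : mpoly L F -> mpoly L G ->
  mE (fun w => F w + G w) = mE F + mE G.
Proof.
move=> pF pG; apply/matrixP => a b; rewrite !mxE -cED; try exact: int.
by apply: eq_cE => w; rewrite mxE.
Qed.

Lemma mE_mull m n k (A : 'M[C]_(k, m)) (F : T -> 'M[C]_(m, n)) : mpoly L F ->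
  mE (fun w => A *m F w) = A *m mE F.
Proof.
move=> pF; apply/matrixP => a b; rewrite !mxE.
transitivity (cE (fun w => \sum_j A a j * F w j b)).
  by apply: eq_cE => w; rewrite mxE.
rewrite cE_sum; last by move=> j; apply: cintegrableZ; exact: int.
by apply: eq_bigr => j _; rewrite mxE cEZ//; exact: int.
Qed.

Lemma mE_hT m n (F : T -> 'M[C]_(m, n)) : mpoly L F ->
  mE (fun w => hT (F w)) = hT (mE F).
Proof.
move=> pF; apply/matrixP => a b; rewrite !mxE -cE_conj; last exact: int.
by apply: eq_cE => w; rewrite !mxE.
Qed.

Lemma eq_mE m n (F G : T -> 'M[C]_(m, n)) : F =1 G -> mE F = mE G.
Proof. by move=> /funext ->. Qed.

End matrix_expectation.

Section lmmse.
Local Open Scope complex_scope.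
Context {R : realType} {d : measure_display} {T : measurableType d}.
Variables (P : probability T R) (Z : nat -> T -> R).
Hypothesis normalZ : forall k, std_normal_rv P (Z k).
Hypothesis indepZ : mutually_independent P Z.
Local Notation C := R[i].
Local Notation mpoly := (mpoly Z predT).
Local Notation mE := (mE P).

Lemma mE_mulr m n k (F : T -> 'M[C]_(m, n)) (A : 'M[C]_(n, k)) : mpoly F ->
  mE (fun w => F w *m A) = mE F *m A.
Proof.
move=> pF; rewrite -[LHS]hTK -(@mE_hT _ _ _ _ _ normalZ indepZ predT); last first.
  by apply: mpolyM => //; exact: mpoly_cst.
rewrite (eq_mE _ (G := fun w => hT A *m hT (F w))); last first.
  by move=> w; rewrite hTM.
rewrite (mE_mull normalZ indepZ (L := predT)); last exact: mpoly_hT.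
by rewrite (mE_hT normalZ indepZ pF) hTM !hTK.
Qed.

Lemma mvecE n (X : T -> 'cV[C]_n) : mvec P X = mE X.
Proof. by apply/matrixP => a b; rewrite !mxE ord1. Qed.

Lemma covE n m (X : T -> 'cV[C]_n) (Y : T -> 'cV[C]_m) :
  cov P X Y = mE (fun w => (X w - mvec P X) *m hT (Y w - mvec P Y)).
Proof.
apply/matrixP => a b; rewrite !mxE; apply: eq_cE => w.
by rewrite !mxE big_ord1 !mxE.
Qed.

Lemma mE_centered n (X : T -> 'cV[C]_n) : mpoly X ->
  mE (fun w => X w - mvec P X) = 0.
Proof.
move=> pX; rewrite (mED normalZ indepZ (L := predT) pX); last exact: mpoly_cst.
by rewrite mE_cst mvecE subrr.
Qed.

Lemma hform_second_moment n (v : 'cV[C]_n) (X : T -> 'cV[C]_n) : mpoly X ->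
  hform (mE (fun w => X w *m hT (X w))) v v =
  cE P (fun w => (hT v *m X w) 0 0 * conjc ((hT v *m X w) 0 0)).
Proof.
move=> pX; have pXX : mpoly (fun w => X w *m hT (X w)).
  by apply: mpolyM => //; exact: mpoly_hT.
rewrite /hform -(mE_mull normalZ indepZ _ pXX).
rewrite -mE_mulr; last by apply: mpolyM => //; exact: mpoly_cst.
rewrite mxE; apply: eq_cE => w.
have -> : hT v *m (X w *m hT (X w)) *m v = (hT v *m X w) *m hT (hT v *m X w).
  by rewrite hTM hTK !mulmxA.
by rewrite mxE big_ord1 [X in _ * X]mxE [X in _ * X]mxE.
Qed.

Lemma psd_second_moment n (X : T -> 'cV[C]_n) : mpoly X ->
  psd (mE (fun w => X w *m hT (X w))).
Proof.
move=> pX; have pXX : mpoly (fun w => X w *m hT (X w)).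
  by apply: mpolyM => //; exact: mpoly_hT.
split.
  rewrite -(mE_hT normalZ indepZ pXX); apply: eq_mE => w.
  by rewrite hTM hTK.
move=> v; rewrite (hform_second_moment v pX).
by apply: cE_ge0 => w; exact: mulcJ_ge0.
Qed.

Section pair.
Variables (n m : nat) (X : T -> 'cV[C]_n) (Y : T -> 'cV[C]_m).
Hypotheses (pX : mpoly X) (pY : mpoly Y).
Hypothesis uY : cov P Y Y \in unitmx.
Local Notation Xc := (fun w => X w - mvec P X).
Local Notation Yc := (fun w => Y w - mvec P Y).
Let G := cov P X Y *m invmx (cov P Y Y).
Let Xhat w := mvec P X + G *m (Y w - mvec P Y).
Let errcov := cov P X X - cov P X Y *m invmx (cov P Y Y) *m hT (cov P X Y).

Let pXc : mpoly Xc. Proof. by apply: mpolyB => //; exact: mpoly_cst. Qed.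
Let pYc : mpoly Yc. Proof. by apply: mpolyB => //; exact: mpoly_cst. Qed.
Let pGYc : mpoly (fun w => G *m Yc w).
Proof. by apply: mpolyM => //; exact: mpoly_cst. Qed.

Lemma mpoly_lmmse : mpoly Xhat.
Proof. by apply: mpolyD => //; exact: mpoly_cst. Qed.

Let second_moment_shift k (mu : 'cV[C]_k) (W : T -> 'cV[C]_k) : mpoly W ->
  mE W = 0 ->
  mE (fun w => (mu + W w) *m hT (mu + W w)) =
  mu *m hT mu + mE (fun w => W w *m hT (W w)).
Proof.
move=> pW W0.
have pWh : mpoly (fun w => hT (W w)) by exact: mpoly_hT.
rewrite (eq_mE _ (G := fun w => mu *m hT mu + (mu *m hT (W w) +
  (W w *m hT mu + W w *m hT (W w))))); last first.
  by move=> w; rewrite hTD mulmxDl !mulmxDr !addrA.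
have pc k' l' (A : 'M[C]_(k', l')) : mpoly (fun=> A) by exact: mpoly_cst.
have p1 : mpoly (fun w => mu *m hT (W w)) by exact: mpolyM.
have p2 : mpoly (fun w => W w *m hT mu) by exact: mpolyM.
have p3 : mpoly (fun w => W w *m hT (W w)) by exact: mpolyM.
rewrite (mED normalZ indepZ (L := predT))//; last by do 2?apply: mpolyD.
rewrite (mED normalZ indepZ (L := predT))//; last by apply: mpolyD.
rewrite (mED normalZ indepZ (L := predT))//.
rewrite mE_cst (mE_mull normalZ indepZ _ pWh) (mE_hT normalZ indepZ pW).
rewrite mE_mulr// W0 mul0mx.
have -> : hT (0 : 'cV[C]_k) = 0 by apply/matrixP => a b; rewrite !mxE conjc0.
by rewrite mulmx0 !add0r.
Qed.

Let covXX : cov P X X = mE (fun w => Xc w *m hT (Xc w)).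
Proof. exact: covE. Qed.

Let hTYY : hT (cov P Y Y) = cov P Y Y.
Proof. by rewrite covE; have [] := psd_second_moment pYc. Qed.

Let GYY : mE (fun w => (G *m Yc w) *m hT (G *m Yc w)) =
  cov P X Y *m invmx (cov P Y Y) *m hT (cov P X Y).
Proof.
rewrite (eq_mE _ (G := fun w => G *m (Yc w *m hT (Yc w)) *m hT G)); last first.
  by move=> w; rewrite hTM !mulmxA.
have pYY : mpoly (fun w => Yc w *m hT (Yc w)).
  by apply: mpolyM => //; exact: mpoly_hT.
rewrite mE_mulr; last by apply: mpolyM => //; exact: mpoly_cst.
rewrite (mE_mull normalZ indepZ _ pYY) -covE /G mulmxKV//.
by rewrite hTM hT_invmx hTYY mulmxA.
Qed.

(** Expanding the error X - Xhat, the terms - G C_yx and G C_yy G^H cancel because G C_yy = C_xy;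
    this is the orthogonality of the error to the observation. *)
Lemma lmmse_errcov :
  errcov = mE (fun w => (X w - Xhat w) *m hT (X w - Xhat w)).
Proof.
pose e w := Xc w - G *m Yc w.
rewrite (eq_mE _ (G := fun w => e w *m hT (e w))); last first.
  by move=> w; rewrite /e /Xhat opprD addrA.
have pYh : mpoly (fun w => hT (Yc w)) by exact: mpoly_hT.
have pXh : mpoly (fun w => hT (Xc w)) by exact: mpoly_hT.
have pc k' l' (A : 'M[C]_(k', l')) : mpoly (fun=> A) by exact: mpoly_cst.
have p0 : mpoly (fun w => Xc w *m hT (Xc w)) by exact: mpolyM.
have pxy : mpoly (fun w => Xc w *m hT (Yc w)) by exact: mpolyM.
have pyx : mpoly (fun w => Yc w *m hT (Xc w)) by exact: mpolyM.
have p1 : mpoly (fun w => (Xc w *m hT (Yc w)) *m (- hT G)) by exact: mpolyM.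
have p2 : mpoly (fun w => (- G) *m (Yc w *m hT (Xc w))) by exact: mpolyM.
have p3 : mpoly (fun w => (G *m Yc w) *m hT (G *m Yc w)).
  by apply: mpolyM => //; exact: mpoly_hT.
rewrite (eq_mE _ (G := fun w => Xc w *m hT (Xc w) +
  ((Xc w *m hT (Yc w)) *m (- hT G) + ((- G) *m (Yc w *m hT (Xc w)) +
  (G *m Yc w) *m hT (G *m Yc w))))); last first.
  move=> w; rewrite /e; move: (Xc w) (Yc w) G => x y g.
  rewrite hTB mulmxBl !mulmxBr hTM !mulNmx !mulmxN !mulmxA opprB -addrA.
  by congr (_ + (_ + _)); rewrite addrC.
rewrite (mED normalZ indepZ (L := predT))//; last by do 2?apply: mpolyD.
rewrite (mED normalZ indepZ (L := predT))//; last by apply: mpolyD.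
rewrite (mED normalZ indepZ (L := predT))//.
rewrite GYY mE_mulr// (mE_mull normalZ indepZ _ pyx) -covXX -covE.
have -> : mE (fun w => Yc w *m hT (Xc w)) = hT (cov P X Y).
  rewrite covE -(mE_hT normalZ indepZ pxy); apply: eq_mE => w.
  by rewrite hTM hTK.
rewrite mulNmx mulmxN addNr addr0 /errcov; congr (_ - _).
by rewrite hTM hT_invmx hTYY mulmxA.
Qed.

Lemma psd_lmmse_errcov : psd errcov.
Proof.
rewrite lmmse_errcov; apply: psd_second_moment.
by apply: mpolyB => //; exact: mpoly_lmmse.
Qed.

(** [X] and its estimate have the same mean, so the mean terms cancel and the raw second moments
    differ exactly as the covariances do. *)
Lemma lmmse_second_moment :
  mE (fun w => X w *m hT (X w)) - mE (fun w => Xhat w *m hT (Xhat w)) = errcov.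
Proof.
rewrite (eq_mE _ (G := fun w => (mvec P X + Xc w) *m hT (mvec P X + Xc w))); last first.
  by move=> w; rewrite addrCA subrr addr0.
rewrite second_moment_shift//; last exact: mE_centered.
rewrite /Xhat second_moment_shift//; last first.
  by rewrite (mE_mull normalZ indepZ _ pYc) mE_centered// mulmx0.
by rewrite GYY -covXX opprD addrACA subrr add0r.
Qed.

Lemma lmmse_sqr_le (a : 'I_n) :
  cE P (fun w => Xhat w a 0 * conjc (Xhat w a 0)) <=
  cE P (fun w => X w a 0 * conjc (X w a 0)).
Proof.
have := psd_diag_ge0 a psd_lmmse_errcov.
rewrite -lmmse_second_moment !mxE subr_ge0.
by congr (_ <= _); apply: eq_cE => w; rewrite !mxE big_ord1 !mxE.
Qed.

End pair.
End lmmse.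

(** * The channel model *)

Section channel_model.
Local Open Scope complex_scope.
Context {R : realType} {d : measure_display} {T : measurableType d}.
Variables (P : probability T R) (Z : nat -> T -> R) (p : sysparams R).
Hypothesis normalZ : forall k, std_normal_rv P (Z k).
Hypothesis indepZ : mutually_independent P Z.
Local Notation C := R[i].
Local Notation cR x := (real_complex R x).
Local Notation cE := (cE P).
Local Notation cpoly := (cpoly Z).
Local Notation mpoly := (mpoly Z).
Local Notation gvar := (@gvar R).

Definition abs2 (z : C) : C := z * conjc z.

Lemma abs2_ge0 z : 0 <= abs2 z. Proof. exact: mulcJ_ge0. Qed.

Lemma abs2M a b : abs2 (a * b) = abs2 a * abs2 b.
Proof. by rewrite /abs2 rmorphM /= mulrACA. Qed.

Lemma abs2_conj a : abs2 (conjc a) = abs2 a.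
Proof. by rewrite /abs2 conjcK mulrC. Qed.

Lemma abs2_sqrt (x : R) : 0 <= x -> abs2 (cR (Num.sqrt x)) = cR x.
Proof.
by move=> x0; rewrite /abs2 conjc_real -rmorphM /= -expr2 sqr_sqrtr.
Qed.

Lemma abs2_expi (t : R) : abs2 (expi t) = 1.
Proof.
rewrite /abs2 /expi; apply/eqP; rewrite eq_complex /=.
rewrite mulrN opprK -!expr2 cos2Dsin2 eqxx /=.
by rewrite mulrN mulrC addNr.
Qed.

Lemma cE_abs2_gauss_sum (I : eqType) (L : pred (seq nat)) (r : seq I)
    (lab : I -> seq nat) (F : I -> T -> C) (Y X : T -> C) :
  uniq [seq lab i | i <- r] -> (forall i, i \in r -> ~~ L (lab i)) ->
  cpoly L Y -> (forall i, cpoly L (F i)) ->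
  (forall w, X w = Y w + \sum_(i <- r) F i w * cgauss Z (lab i) w) ->
  cE (fun w => abs2 (X w)) = cE (fun w => abs2 (Y w)) +
    gvar * \sum_(i <- r) cE (fun w => abs2 (F i w)).
Proof.
move=> ur Lr pY pF /funext ->.
exact: (cE_sqr_gauss_sum _ _ normalZ indepZ _ _ _ _ _ _ ur Lr pY pF).
Qed.

(** The head of a label is its family: 0 to 2 for the channels, 3 and 4 for the impairments, 5 for
    the noise. So [hlt 3] allows the channels alone and [hlt 5] everything but the noise. *)
Definition hlt (k : nat) : pred (seq nat) := fun c => (head 0 c < k)%N.

Let pc L m n (A : 'M[C]_(m, n)) : mpoly L (fun=> A).
Proof. exact: mpoly_cst. Qed.

Lemma mpolyZc L m n (c : C) (F : T -> 'M[C]_(m, n)) :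
  mpoly L F -> mpoly L (fun w => c *: F w).
Proof. by move=> pF; apply: mpolyZ => //; exact: cpoly_cst. Qed.

Lemma mpolyW (L L' : pred (seq nat)) m n (F : T -> 'M[C]_(m, n)) :
  (forall c, L c -> L' c) -> mpoly L F -> mpoly L' F.
Proof. by move=> LL' pF a b; exact: cpolyW LL' (pF a b). Qed.

Lemma mpoly_gauss (L : pred (seq nat)) m n (lab : 'I_m -> 'I_n -> seq nat) :
  (forall a b, L (lab a b)) ->
  mpoly L (fun w => \matrix_(a, b) cgauss Z (lab a b) w).
Proof.
move=> Llab a b; apply: (@eq_cpoly _ _ _ _ _ (cgauss Z (lab a b))).
  by move=> w; rewrite mxE.
exact: cpoly_cgauss.
Qed.

Lemma mpoly_gvec (L : pred (seq nat)) i :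
  (forall c, head 0%N c = 1%N -> L c) -> mpoly L (gvec Z p i).
Proof.
move=> HL; apply: mpolyD; apply: mpolyZc; first exact: pc.
by apply: mpoly_gauss => a b; exact: HL.
Qed.

Lemma mpoly_Amat (L : pred (seq nat)) i :
  (forall c, head 0%N c = 2%N -> L c) -> mpoly L (Amat Z p i).
Proof.
move=> HL; apply: mpolyD; apply: mpolyZc; first exact: pc.
by apply: mpoly_gauss => a b; exact: HL.
Qed.

Lemma mpoly_hch i : mpoly (hlt 3) (hch Z p i).
Proof.
apply: mpolyD; apply: mpolyZc.
  apply: mpolyM; first apply: mpolyM => //.
  - by apply: mpoly_Amat => c; rewrite /hlt => ->.
  - by apply: mpoly_gvec => c; rewrite /hlt => ->.
exact: mpoly_gauss.
Qed.

Definition yobs i w := xobs Z p i w - wnoise Z p i w.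

Lemma mpoly_yobs i : mpoly (hlt 5) (yobs i).
Proof.
have ph j : mpoly (hlt 5) (hch Z p j).
  by apply: mpolyW (mpoly_hch j) => c; rewrite /hlt => /ltn_trans; apply.
have pu o j c : mpoly (hlt 5) (fun w => (c * uimp Z o j w) *: hch Z p j w).
  apply: mpolyZ => //; apply: cpolyM; first exact: cpoly_cst.
  exact: cpoly_cgauss.
have pv o j c : mpoly (hlt 5)
    (fun w => c *: hadam (hch Z p j w) (vimp Z p o j w)).
  apply: mpolyZc => a b.
  apply: (@eq_cpoly _ _ _ _ _ (fun w => hch Z p j w a 0 *
    cgauss Z [:: 4; ucode o; ucode j; nat_of_ord a] w)).
    by move=> w; rewrite !mxE.
  by apply: cpolyM; [exact: ph|exact: cpoly_cgauss].
move=> a b; apply: (@eq_cpoly _ _ _ Z _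
  (fun w => (xobs Z p i w - wnoise Z p i w) a b)) => //.
rewrite /xobs; under eq_fun do rewrite addrK.
move: a b; do 4 (apply: mpolyD => //).
exact: mpolyZc.
Qed.

Lemma mpoly_wnoise i : mpoly predT (wnoise Z p i).
Proof. by apply: mpolyZc; exact: mpoly_gauss. Qed.

Lemma mpoly_xobs i : mpoly predT (xobs Z p i).
Proof.
move=> a b; apply: (@eq_cpoly _ _ _ _ _ (fun w => (yobs i w + wnoise Z p i w) a b)).
  by move=> w; rewrite /yobs subrK.
apply: mpolyD; last exact: mpoly_wnoise.
exact: mpolyW (mpoly_yobs i).
Qed.

Lemma mpoly_hchT i : mpoly predT (hch Z p i).
Proof. exact: mpolyW (mpoly_hch i). Qed.

(** The noise is fresh relative to [yobs], so v^H C_xx v is a nonnegative second moment plus [gvar]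
    sigma_w^2 |v|^2, hence positive for v != 0. *)
Lemma Cxx_unit i : 0 < sigw2 p -> Cxx P Z p i \in unitmx.
Proof.
move=> s0; apply: posdef_unitmx => v v0.
pose xc w := xobs Z p i w - mvec P (xobs Z p i).
have pxc : mpoly predT xc by apply: mpolyB => //; exact: mpoly_xobs.
rewrite /Cxx covE (hform_second_moment normalZ indepZ v pxc).
pose Y w := (hT v *m (yobs i w - mvec P (xobs Z p i))) 0 0.
pose F (m : 'I_(M p)) (w : T) := conjc (v m 0) * cR (Num.sqrt (sigw2 p)).
pose lab (m : 'I_(M p)) := [:: 5; ucode i; nat_of_ord m]%N.
have -> := @cE_abs2_gauss_sum _ (hlt 5) (index_enum _) lab F Y
  (fun w => (hT v *m xc w) 0 0).
- rewrite ltr_wpDl//.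
    by apply: cE_ge0 => w; exact: abs2_ge0.
  rewrite mulr_gt0 ?gvar_gt0//.
  rewrite (eq_bigr (fun m => v m 0 * conjc (v m 0) * cR (sigw2 p))); last first.
    by move=> m _; rewrite /F cE_cst abs2M abs2_conj abs2_sqrt ?(ltW s0).
  rewrite -mulr_suml mulr_gt0 ?ltcR//.
  by have := sqnorm_gt0 v0; rewrite sqnormE.
- rewrite map_inj_uniq ?index_enum_uniq// => m m' [] /ord_inj //.
- by [].
- have pY : mpoly (hlt 5) (fun w => hT v *m (yobs i w - mvec P (xobs Z p i))).
    by apply: mpolyM => //; apply: mpolyB => //; exact: mpoly_yobs.
  exact: pY.
- by move=> m; exact: cpoly_cst.
- move=> w; rewrite /Y /xc.
  have -> : xobs Z p i w = yobs i w + wnoise Z p i w by rewrite subrK.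
  rewrite addrAC mulmxDr mxE; congr (_ + _); rewrite mxE.
  by apply: eq_bigr => m _; rewrite /F !mxE mulrA.
Qed.

(** * Second moment of one channel entry *)

Section second_moment.
Hypotheses (rA : forall i, 0 < rhoA p i) (rg : forall i, 0 < rhog p i)
  (rb : forall i, 0 < rhob p i) (kA : forall i, 0 <= kapA p i)
  (kg : forall i, 0 <= kapg p i)
  (gain : forall i, gainIOS p i = ((Nel p i)%:R ^+ 2)%:C).
Variables (i : user) (m : 'I_(M p)).

Let s := cR (Num.sqrt (rhoA p i * rhog p i)).
Let al := cR (Num.sqrt (kapA p i / (1 + kapA p i))).
Let al' := cR (Num.sqrt (1 / (1 + kapA p i))).
Let ga := cR (Num.sqrt (kapg p i / (1 + kapg p i))).
Let ga' := cR (Num.sqrt (1 / (1 + kapg p i))).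
Let e n := expi (theta p i n).
Let NN := cR (Nel p i)%:R.

Let s2 : abs2 s = cR (rhoA p i * rhog p i).
Proof. by rewrite abs2_sqrt// mulr_ge0 ?ltW. Qed.
Let al2 : abs2 al = cR (kapA p i / (1 + kapA p i)).
Proof. by rewrite abs2_sqrt// divr_ge0 ?addr_ge0. Qed.
Let al'2 : abs2 al' = cR (1 / (1 + kapA p i)).
Proof. by rewrite abs2_sqrt// divr_ge0 ?addr_ge0. Qed.
Let ga2 : abs2 ga = cR (kapg p i / (1 + kapg p i)).
Proof. by rewrite abs2_sqrt// divr_ge0 ?addr_ge0. Qed.
Let ga'2 : abs2 ga' = cR (1 / (1 + kapg p i)).
Proof. by rewrite abs2_sqrt// divr_ge0 ?addr_ge0. Qed.

Let sum_const (c : C) : \sum_(n < Nel p i) c = NN * c.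
Proof. by rewrite sumr_const card_ord /NN rmorph_nat mulr_natl. Qed.

Let H w := \sum_(n < Nel p i) s * (Amat Z p i w m n * e n * gvec Z p i w n 0).

Let hE w : hch Z p i w m 0 = H w + cR (Num.sqrt (rhob p i)) * bvec Z p i w m 0.
Proof.
rewrite /hch mxE [X in X + _]mxE [X in _ + X]mxE; congr (_ + _).
rewrite /H -mulr_sumr mxE; congr (_ * _); apply: eq_bigr => n _; congr (_ * _).
by rewrite /Theta mul_mx_diag mxE [X in _ * X]mxE.
Qed.

Let Abar2 n : abs2 (Abar p i m n) = 1.
Proof.
by rewrite /Abar mxE big_ord1 !mxE abs2M abs2_conj !abs2_expi mulr1.
Qed.

Let gbar2 n : abs2 (gbar p i n 0) = 1.
Proof. by rewrite /gbar mxE abs2_expi. Qed.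

(** The line-of-sight row of A_i applied to Theta_i g_i: up to the factor [s * al], the mean of [H]
    given g_i. *)
Let B w := \sum_(n < Nel p i) Abar p i m n * e n * gvec Z p i w n 0.

Let gE w n : gvec Z p i w n 0 =
  ga * gbar p i n 0 + ga' * cgauss Z [:: 1; ucode i; nat_of_ord n]%N w.
Proof. by rewrite /gvec !mxE. Qed.

Let AE w n : Amat Z p i w m n =
  al * Abar p i m n +
  al' * cgauss Z [:: 2; ucode i; nat_of_ord m; nat_of_ord n]%N w.
Proof. by rewrite /Amat !mxE. Qed.

Let pg n : cpoly (fun c => head 0 c == 1)%N (fun w => gvec Z p i w n 0).
Proof.
have := @mpoly_gvec (fun c => head 0 c == 1)%N i; apply=> c ->//.
Qed.

Let Eg n : cE (fun w => abs2 (gvec Z p i w n 0)) = abs2 ga + gvar * abs2 ga'.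
Proof.
rewrite (@cE_abs2_gauss_sum unit pred0 [:: tt]
  (fun=> [:: 1; ucode i; nat_of_ord n]%N) (fun _ _ => ga')
  (fun=> ga * gbar p i n 0))//.
- by cbv beta; rewrite cE_cst abs2M gbar2 mulr1 big_seq1 cE_cst.
- exact: cpoly_cst.
- by move=> ?; exact: cpoly_cst.
- by move=> w; rewrite big_seq1 gE.
Qed.

(** [Abar] has rank one, so the sum is a unimodular AP entry times the scalar whose squared modulus
    is [gainIOS]; the choice of phase shifts enters here. *)
Let barB2 : abs2 (\sum_(n < Nel p i) Abar p i m n * e n * gbar p i n 0) = NN ^+ 2.
Proof.
have -> : \sum_(n < Nel p i) Abar p i m n * e n * gbar p i n 0 =
    abarAP p i m 0 * (hT (abarIOS p i) *m Theta p i *m gbar p i) 0 0.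
  rewrite [X in _ * X]mxE mulr_sumr; apply: eq_bigr => n _.
  by rewrite /Theta mul_mx_diag /Abar !mxE big_ord1 !mxE !mulrA.
rewrite abs2M {1}/abarAP mxE abs2_expi mul1r.
by have := gain i; rewrite /gainIOS /abs2 => ->; rewrite /NN rmorphXn.
Qed.

Let EB : cE (fun w => abs2 (B w)) = abs2 ga * NN ^+ 2 + gvar * (NN * abs2 ga').
Proof.
rewrite (@cE_abs2_gauss_sum _ pred0 (index_enum 'I_(Nel p i))
  (fun n => [:: 1; ucode i; nat_of_ord n]%N)
  (fun n _ => ga' * (Abar p i m n * e n))
  (fun=> ga * \sum_(n < Nel p i) Abar p i m n * e n * gbar p i n 0))//.
- cbv beta; rewrite cE_cst abs2M barB2; congr (_ + _ * _).
  rewrite -sum_const; apply: eq_bigr => n _.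
  by rewrite cE_cst !abs2M Abar2 abs2_expi !mulr1.
- rewrite map_inj_uniq ?index_enum_uniq// => n n' [] /ord_inj //.
- exact: cpoly_cst.
- by move=> ?; exact: cpoly_cst.
- move=> w; rewrite mulr_sumr -big_split; apply: eq_bigr => n _ /=.
  by rewrite gE; ring.
Qed.

(** The Gaussian part of A_i is averaged out first, with coefficients that are polynomials in g_i;
    the remaining moments, [EB] and [Eg], involve g_i alone. *)
Let EH : cE (fun w => abs2 (H w)) = abs2 s * (abs2 al *
   (abs2 ga * NN ^+ 2 + gvar * (NN * abs2 ga')) +
   gvar * (NN * (abs2 al' * (abs2 ga + gvar * abs2 ga')))).
Proof.
have pe L c (X : T -> C) : cpoly L X -> cpoly L (fun w => c * X w).
  by move=> pX; apply: cpolyM => //; exact: cpoly_cst.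
have int X : cpoly (fun c => head 0 c == 1)%N X -> cintegrable P X.
  exact: cpoly_integrable.
have pB : cpoly (fun c => head 0 c == 1)%N B.
  by apply: cpoly_sum => n; exact: pe.
have pabs X : cpoly (fun c => head 0 c == 1)%N X ->
    cpoly (fun c => head 0 c == 1)%N (fun w => abs2 (X w)).
  by move=> pX; apply: cpolyM => //; exact: cpoly_conj.
have EZ c X : cpoly (fun c => head 0 c == 1)%N X ->
    cE (fun w => abs2 (c * X w)) = abs2 c * cE (fun w => abs2 (X w)).
  move=> pX; rewrite -cEZ; last exact/int/pabs.
  by apply: eq_cE => w; rewrite abs2M.
rewrite (@cE_abs2_gauss_sum _ (fun c => head 0 c == 1)%N
  (index_enum 'I_(Nel p i))
  (fun n => [:: 2; ucode i; nat_of_ord m; nat_of_ord n]%N)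
  (fun n w => s * al' * e n * gvec Z p i w n 0)
  (fun w => s * al * B w))//.
- cbv beta; rewrite EZ// EB abs2M [RHS]mulrDr; congr (_ + _); first by rewrite -mulrA.
  rewrite [RHS]mulrCA; congr (_ * _); rewrite [RHS]mulrCA -sum_const.
  apply: eq_bigr => n _; rewrite EZ// Eg !abs2M abs2_expi mulr1.
  by rewrite -mulrA.
- rewrite map_inj_uniq ?index_enum_uniq// => n n' [] /ord_inj //.
- exact: pe.
- by move=> n; exact: pe.
- move=> w; rewrite /H /B mulr_sumr -big_split; apply: eq_bigr => n _ /=.
  by rewrite AE; ring.
Qed.

Lemma hch_second_moment_le :
  cE (fun w => hch Z p i w m 0 * conjc (hch Z p i w m 0)) <= cR (Defs.eta p i).
Proof.
have -> : cE (fun w => hch Z p i w m 0 * conjc (hch Z p i w m 0)) =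
    cE (fun w => abs2 (H w)) + gvar * cR (rhob p i).
  rewrite -(@abs2_sqrt (rhob p i)) ?(ltW (rb i))//.
  rewrite (_ : cE _ = cE (fun w => abs2 (hch Z p i w m 0)))//.
  rewrite (@cE_abs2_gauss_sum unit (fun c => 0 < head 0 c)%N [:: tt]
    (fun=> [:: 0; ucode i; nat_of_ord m]%N)
    (fun _ _ => cR (Num.sqrt (rhob p i))) H)//.
  - by rewrite big_seq1 cE_cst.
  - apply: cpoly_sum => n; do 3?apply: cpolyM; try exact: cpoly_cst.
      by have := @mpoly_Amat (fun c => 0 < head 0 c)%N i; apply=> c ->.
    by have := @mpoly_gvec (fun c => 0 < head 0 c)%N i; apply=> c ->.
  - by move=> _; exact: cpoly_cst.
  - by move=> w; rewrite big_seq1 hE /bvec mxE.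
rewrite EH s2 al2 al'2 ga2 ga'2 /NN /gvar.
have -> : cR (Nel p i)%:R ^+ 2 = cR ((Nel p i)%:R ^+ 2) by rewrite rmorphXn.
rewrite -!(rmorphM, rmorphD) /= lecR.
set v := Rintegral _ _ _.
have v1 : v <= 1 by exact: std_normal_var_le1.
have v0 : 0 < v by exact: std_normal_var_gt0.
rewrite /Defs.eta; apply: lerD; last by apply: ler_piMl => //; exact: ltW.
have kA1 : 0 < 1 + kapA p i by rewrite ltr_wpDr.
have kg1 : 0 < 1 + kapg p i by rewrite ltr_wpDr.
(* [eta] is put in the shape of [EH] with each [gvar] replaced by an explicit 1. All coefficients
   are nonnegative, so the comparison goes factor by factor. *)
have -> : rhoA p i * rhog p i * (kapA p i * kapg p i * (Nel p i)%:R ^+ 2 +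
    (1 + kapg p i + kapA p i) * (Nel p i)%:R) /
    ((1 + kapA p i) * (1 + kapg p i)) = rhoA p i * rhog p i *
  (kapA p i / (1 + kapA p i) * (kapg p i / (1 + kapg p i) * (Nel p i)%:R ^+ 2 +
   1 * ((Nel p i)%:R * (1 / (1 + kapg p i)))) +
   1 * ((Nel p i)%:R * (1 / (1 + kapA p i) *
    (kapg p i / (1 + kapg p i) + 1 * (1 / (1 + kapg p i)))))).
  by field; rewrite !gt_eqF.
have d1 x : 0 <= x -> 0 <= x / (1 + kapA p i) by move=> ?; rewrite divr_ge0// ltW.
have d2 x : 0 <= x -> 0 <= x / (1 + kapg p i) by move=> ?; rewrite divr_ge0// ltW.
have N0 : 0 <= (Nel p i)%:R :> R by rewrite ler0n.
apply: ler_wpM2l; first by rewrite mulr_ge0 ?ltW.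
apply: lerD.
  apply: ler_wpM2l; first exact: d1.
  by rewrite lerD2l ler_wpM2r// mulr_ge0 ?d2.
apply: ler_pM => //; first exact: ltW.
- apply: mulr_ge0 => //; apply: mulr_ge0; first exact: d1.
  by apply: addr_ge0; [exact: d2|apply: mulr_ge0; [exact: ltW|exact: d2]].
- apply: ler_wpM2l => //; apply: ler_wpM2l; first exact: d1.
  by rewrite lerD2l ler_wpM2r ?d2.
Qed.

End second_moment.
End channel_model.

(** * The rate bound *)

Section rate.
Context {R : realType}.

(** An explicit supporting line takes the place of Jensen's inequality, and its nonnegative slope
    turns an upper bound on the mean into an upper bound on the rate. *)
Lemma rate_tangent (a b X : R) : 0 <= a -> 0 <= b -> 0 <= X ->
  exists2 k, 0 <= k & forall z, 0 <= z ->
    log2 (1 + a * z / (1 + b * z)) <=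
    log2 (1 + a * X / (1 + b * X)) + k * (z - X).
Proof.
move=> a0 b0 X0.
pose t x := 1 + a * x / (1 + b * x).
have bx x : 0 <= x -> 0 < 1 + b * x by move=> x0; rewrite ltr_wpDr ?mulr_ge0.
have tx x : 0 <= x -> 0 < t x.
  by move=> x0; rewrite /t ltr_wpDr// divr_ge0 ?mulr_ge0// ltW// bx.
have l2 : 0 < ln 2 :> R by rewrite ln_gt0// ltr1n.
(* The logarithmic derivative t'(X) / t(X). After ln (1 + y) <= y, what remains is concavity of [t],
   visible as a multiple of (z - X)^2. *)
pose k := a / (t X * (1 + b * X) ^+ 2).
have k0 : 0 <= k.
  by rewrite divr_ge0// mulr_ge0 ?exprn_ge0// ltW ?tx ?bx.
exists (k / ln 2); first by rewrite divr_ge0// ltW.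
move=> z z0; rewrite /log2 -/(t z) -/(t X).
rewrite mulrAC -mulrDl ler_pM2r ?invr_gt0//.
have -> : ln (t z) = ln (t X) + ln (1 + (t z / t X - 1)).
  rewrite addrCA subrr addr0 ln_div ?posrE ?tx//.
  by rewrite addrCA subrr addr0.
rewrite lerD2l; apply: le_trans (le_ln1Dx _) _.
  by rewrite ltrBDr addNr divr_gt0 ?tx.
have tX := tx X X0; have bX := bx X X0; have bz := bx z z0.
rewrite -subr_ge0.
have -> : k * (z - X) - (t z / t X - 1) =
    a * b * (z - X) ^+ 2 / (t X * (1 + b * z) * (1 + b * X) ^+ 2).
  have -> : t z / t X - 1 = (t z - t X) / t X by field; rewrite gt_eqF.
  have -> : t z - t X = a * (z - X) / ((1 + b * z) * (1 + b * X)).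
    by rewrite /t; field; rewrite !gt_eqF.
  by rewrite /k; field; rewrite !gt_eqF.
apply: divr_ge0; first by rewrite mulr_ge0 ?sqr_ge0// mulr_ge0.
by rewrite mulr_ge0 ?sqr_ge0// mulr_ge0// ltW.
Qed.

Lemma log2_ge0 (x : R) : 1 <= x -> 0 <= log2 x.
Proof.
by move=> x1; rewrite divr_ge0// ln_ge0// ler1n.
Qed.

End rate.

(* The integral of a nonnegative function, measurable or not, is a supremum
   over the simple functions below it. *)
Lemma ge0_le_integralT (R : realType) (d : measure_display)
    (T : measurableType d) (mu : {measure set T -> \bar R}) (f g : T -> \bar R) :
  (forall w, 0 <= f w)%E -> (forall w, f w <= g w)%E ->
  (\int[mu]_w f w <= \int[mu]_w g w)%E.
Proof.
move=> f0 fg; have g0 w : (0 <= g w)%E by exact: le_trans (fg w).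
rewrite !ge0_integralTE//; apply: ereal_sup_le => _ [h hf <-].
by exists h => // w; exact: le_trans (fg w).
Qed.

(** * Coercivity of R and the ergodic rate *)

Section main.
Local Open Scope complex_scope.
Context {R : realType} {d : measure_display} {T : measurableType d}.
Variables (P : probability T R) (Z : nat -> T -> R) (p : sysparams R).
Hypothesis normalZ : forall k, std_normal_rv P (Z k).
Hypothesis indepZ : mutually_independent P Z.
Hypotheses (rA : forall i, 0 < rhoA p i) (rg : forall i, 0 < rhog p i)
  (rb : forall i, 0 < rhob p i) (kA : forall i, 0 <= kapA p i)
  (kg : forall i, 0 <= kapg p i) (ev : 0 <= epsv p <= 1)
  (eu : forall i, 0 <= epsu p i <= 1)
  (rho0 : forall i, 0 < rho p i) (sw : 0 < sigw2 p)
  (gain : forall i, gainIOS p i = ((Nel p i)%:R ^+ 2)%:C).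
Local Notation C := R[i].
Local Notation cR x := (real_complex R x).
Local Notation eta := (Defs.eta p).

Let D : R := rho p Ur * (1 - epsv p) * eta Ur + rho p Ut * (1 - epsv p) * eta Ut
  + sigw2 p.

Lemma eta_ge0 i : 0 <= eta i.
Proof.
have hA := ltW (rA i); have hg := ltW (rg i); have hb := ltW (rb i).
rewrite /Defs.eta; apply: addr_ge0 => //; apply: divr_ge0; last first.
  by rewrite mulr_ge0// addr_ge0.
apply: mulr_ge0; first by rewrite mulr_ge0.
apply: addr_ge0; first by rewrite mulr_ge0 ?sqr_ge0// mulr_ge0.
by rewrite mulr_ge0 ?ler0n// !addr_ge0.
Qed.

Let ev0 : 0 <= epsv p. Proof. by case/andP: ev. Qed.
Let ev1 : 0 <= 1 - epsv p. Proof. by rewrite subr_ge0; case/andP: ev. Qed.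
Let eu0 i : 0 <= epsu p i. Proof. by case/andP: (eu i). Qed.
Let eu1 i : 0 <= 1 - epsu p i. Proof. by rewrite subr_ge0; case/andP: (eu i). Qed.
Let rho_ge0 i : 0 <= rho p i. Proof. exact: ltW. Qed.

Let D_gt0 : 0 < D.
Proof. by rewrite /D ltr_wpDl// addr_ge0 ?mulr_ge0 ?eta_ge0. Qed.

(** The gain N_i^2 merges the scattered and line-of-sight parts into [eta], which produces the
    constant [D] in R. *)
Lemma diagtermE i : diagterm p i = cR (rho p i * (1 - epsv p) * eta i).
Proof.
rewrite /diagterm gain -!(rmorphM, rmorphD) /=; congr (cR _).
have kA1 : 1 + kapA p i != 0 by rewrite gt_eqF// ltr_wpDr.
have kg1 : 1 + kapg p i != 0 by rewrite gt_eqF// ltr_wpDr.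
by rewrite /Defs.eta; field; rewrite kA1 kg1.
Qed.

Lemma psd_Cerr i : psd (Cerr P Z p i).
Proof.
apply: (psd_lmmse_errcov normalZ indepZ).
- exact: mpoly_hchT.
- exact: mpoly_xobs.
- exact: Cxx_unit.
Qed.

Let Rm := Rmat P Z p.

Let RmE : Rm = cR (rho p Ur * epsv p * (1 - epsu p Ur)) *: Cerr P Z p Ur
  + cR (rho p Ut * epsv p * (1 - epsu p Ut)) *: Cerr P Z p Ut + (cR D)%:M.
Proof. by rewrite /Rm /Rmat !diagtermE -!rmorphD. Qed.

Let Rm_herm : hT Rm = Rm.
Proof.
have [h1 _] := psd_Cerr Ur; have [h2 _] := psd_Cerr Ut.
rewrite RmE; move: (Cerr P Z p Ur) (Cerr P Z p Ut) h1 h2 => A B hA hB.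
by rewrite !hTD !hTZ !conjc_real hA hB hT_scalar.
Qed.

Let Rm_coercive v : cR D * sqnorm v <= hform Rm v v.
Proof.
have [_ h1] := psd_Cerr Ur; have [_ h2] := psd_Cerr Ut.
rewrite RmE; move: (Cerr P Z p Ur) (Cerr P Z p Ut) h1 h2 => A B hA hB.
rewrite !hformD !hformZ hform_scalar lerDr addr_ge0// mulr_ge0// lecR.
  by rewrite !mulr_ge0.
by rewrite !mulr_ge0.
Qed.

Let D0 : 0 < cR D. Proof. by rewrite ltcR. Qed.

Let Rm_inv_psd : psd (invmx Rm).
Proof. exact: (coercive_inv_psd Rm_herm D0 Rm_coercive). Qed.

Lemma zeta_bounds i w :
  0 <= zeta P Z p i w <= complex.Re (sqnorm (hhat P Z p i w)) / D.
Proof.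
have c0 : 0 <= cR (rho p (other i) * epsv p) by rewrite lecR mulr_ge0.
have /andP[h1 h2] := schur_complement_bounds (hhat P Z p (other i) w)
  (hhat P Z p i w) Rm_inv_psd c0.
have h3 := coercive_inv_le Rm_herm D0 Rm_coercive (hhat P Z p i w).
have {h2}h3 := le_trans h2 h3.
move: h1 h3; rewrite !lecE => /andP[_ h1] /andP[_ h3].
apply/andP; split; first exact: h1.
apply: (le_trans h3).
have -> : sqnorm (hhat P Z p i w) / cR D = cR (D^-1) * sqnorm (hhat P Z p i w).
  by rewrite mulrC fmorphV.
by case: (sqnorm _) => x y /=; rewrite mul0r subr0 mulrC.
Qed.

Lemma mpoly_hhat i : mpoly Z predT (hhat P Z p i).
Proof. by apply: mpoly_lmmse; exact: mpoly_xobs. Qed.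

Lemma cE_sqnorm_hhat i :
  cE P (fun w => sqnorm (hhat P Z p i w)) <= cR ((M p)%:R * eta i).
Proof.
have pab (m : 'I_(M p)) : cpoly Z predT
    (fun w => hhat P Z p i w m 0 * conjc (hhat P Z p i w m 0)).
  have ph := mpoly_hhat i m 0.
  by apply: cpolyM => //; exact: cpoly_conj.
rewrite (@eq_cE _ _ _ _ _ (fun w => \sum_m
    (hhat P Z p i w m 0 * conjc (hhat P Z p i w m 0)))); last first.
  by move=> w; rewrite sqnormE.
rewrite (@cE_sum _ _ _ _ _ _
  (fun m w => hhat P Z p i w m 0 * conjc (hhat P Z p i w m 0))); last first.
  by move=> m; exact: cpoly_integrable (pab m).
apply: (@le_trans _ _ (\sum_(m < M p) cR (eta i))).
  apply: ler_sum => m _.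
  apply: le_trans (hch_second_moment_le normalZ indepZ rA rg rb kA kg gain i m).
  apply: (lmmse_sqr_le normalZ indepZ).
  - exact: mpoly_hchT.
  - exact: mpoly_xobs.
  - exact: Cxx_unit.
by rewrite sumr_const card_ord rmorphM /= rmorph_nat mulr_natl.
Qed.

Lemma ergodic_rate_le i : (Rerg P Z p i <= (Rddot p i)%:E)%E.
Proof.
set a := rho p i * epsv p * epsu p i.
set b := rho p i * epsv p * (1 - epsu p i).
pose X := (M p)%:R * eta i / D.
have a0 : 0 <= a by rewrite !mulr_ge0.
have b0 : 0 <= b by rewrite !mulr_ge0.
have X0 : 0 <= X by rewrite divr_ge0 ?mulr_ge0 ?ler0n ?eta_ge0// ltW.
have [k k0 tangent] := rate_tangent a0 b0 X0.
(* Numerator and denominator of the claimed bound are divided by [D], so the bound is the rate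
   function at [X]. *)
have -> : Rddot p i = log2 (1 + a * X / (1 + b * X)).
  rewrite /Rddot; congr (log2 (1 + _)).
  have h : 0 <= b * (M p)%:R * eta i by rewrite !mulr_ge0 ?ler0n ?eta_ge0.
  rewrite -[in LHS]addrA -[in LHS]addrA [in LHS](addrA (_ * eta Ur)) -/D -/a -/b.
  rewrite /X; field; rewrite gt_eqF//= gt_eqF//.
  by rewrite ltr_wpDr// mulrA.
set t0 := log2 _.
pose Y w := complex.Re (sqnorm (hhat P Z p i w)) / D.
have pS : cpoly Z predT (fun w => sqnorm (hhat P Z p i w)).
  have ph := mpoly_hhat i; have := mpolyM (mpoly_hT ph) ph => /(_ 0 0).
  exact.
have [iS _] := cpoly_integrable _ _ normalZ indepZ _ _ pS.
have iY : P.-integrable setT (EFin \o Y).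
  have := integrableZl measurableT D^-1 iS; congr (integrable _ _ _).
  by apply/funext => w /=; rewrite /Y mulrC.
have iF : P.-integrable setT (EFin \o (fun w => t0 + k * (Y w - X))).
  have := integrableD measurableT
    (@finite_measure_integrable_cst _ _ _ P _ (t0 - k * X) measurableT)
    (integrableZl measurableT k iY).
  congr (integrable _ _ _).
  by apply/funext => w /=; rewrite -EFinM -EFinD; congr EFin; ring.
have EY : Rintegral P setT Y <= X.
  have -> : Rintegral P setT Y =
      Rintegral P setT (fun w => complex.Re (sqnorm (hhat P Z p i w))) / D.
    by rewrite -RintegralZr.
  rewrite /X ler_pM2r ?invr_gt0//.
  by have := cE_sqnorm_hhat i; rewrite lecE => /andP[_].
(* The lower bound on [zeta] makes the rate nonnegative, as [ge0_le_integralT] requires; the upper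
   bound passes through the tangent because k >= 0. The majorant is affine in [Y], hence
   integrable. *)
apply: (@le_trans _ _ (\int[P]_w (t0 + k * (Y w - X))%:E)%E).
  apply: ge0_le_integralT => w; have /andP[z0 zY] := zeta_bounds i w.
    rewrite lee_fin log2_ge0// lerDl divr_ge0 ?mulr_ge0 ?addr_ge0 ?mulr_ge0//.
  rewrite lee_fin; apply: (le_trans (tangent _ z0)).
  by rewrite lerD2l ler_wpM2l// lerD2r.
have -> : (\int[P]_w (t0 + k * (Y w - X))%:E =
    (Rintegral P setT (fun w => t0 + k * (Y w - X)))%:E)%E.
  by rewrite /Rintegral fineK//; exact: integrable_fin_num iF.
rewrite lee_fin.
have -> : Rintegral P setT (fun w => t0 + k * (Y w - X)) =
    (t0 - k * X) + k * Rintegral P setT Y.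
  have PT : fine (P setT) = 1 by rewrite probability_setT.
  have -> : t0 - k * X = Rintegral P setT (fun=> t0 - k * X).
    by rewrite Rintegral_cst// PT mulr1.
  rewrite -RintegralZl// -RintegralD//.
  - by apply: eq_Rintegral => w _; rewrite -/(Y w); ring.
  - exact: (@finite_measure_integrable_cst _ _ _ P _ (t0 - k * X) measurableT).
  - by have := integrableZl measurableT k iY.
have : k * Rintegral P setT Y <= k * X by exact: ler_wpM2l.
lra.
Qed.

End main.

Unset Implicit Arguments.

Theorem theorem5 (R : realType) (d : measure_display) (T : measurableType d)
  (P : probability T R) (Z : nat -> T -> R) (p : sysparams R) :
  (forall k, std_normal_rv P (Z k)) ->
  mutually_independent P Z ->
  0 < lambda p ->
  (forall i, 0 < rhoA p i) -> (forall i, 0 < rhog p i) -> (forall i, 0 < rhob p i) ->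
  (forall i, 0 <= kapA p i) -> (forall i, 0 <= kapg p i) ->
  (forall i (n : 'I_(Nx p i * Ny p i)), 0 <= theta p i n < 2 * pi) ->
  0 <= epsv p <= 1 -> (forall i, 0 <= epsu p i <= 1) ->
  (forall i, 0 < rho p i) -> 0 < sigw2 p -> (1 <= K p)%N ->
  (forall i, gainIOS p i = ((Nel p i)%:R ^+ 2)%:C%C) ->
  forall i : user, (Rerg P Z p i <= (Rddot p i)%:E)%E.
Proof.
move=> normalZ indepZ _ rA rg rb kA kg _ ev eu rho0 sw _ gain i.
exact: ergodic_rate_le.
Qed.
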